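(* Let $n\ge2$, let $\boldsymbol z=(z_1,\dots,z_n)$ be distinct complex numbers, let $\Lambda_1,\dots,\Lambda_n\in\mathfrak h^*$ be weights of $\mathfrak{sl}_3$, and let $\boldsymbol l=(l_1,l_2)$ be nonnegative integers. Assume that the complex numbers $\boldsymbol t=(t^{(1)}_1,\dots,t^{(1)}_{l_1},t^{(2)}_1,\dots,t^{(2)}_{l_2})$ are distinct and that $z_s\notin\{t_1^{(i)},\dots,t_{l_i}^{(i)}\}$ for all $s=1,\dots,n$, $i=1,2$. Assume that for this $\boldsymbol t$ the value $\omega_{\boldsymbol l,n}(\boldsymbol t,\boldsymbol z)\in M_{\Lambda_1}\otimes\dots\otimes M_{\Lambda_n}$ of the canonical weight function is an eigenvector of the Gaudin Hamiltonians $H_1(\boldsymbol z),\dots,H_n(\boldsymbol z)$. Then $\boldsymbol t$ is a solution to the $\mathfrak{sl}_3$ Bethe ansatz equations $$\sum_{s=1}^{n}\frac{(\Lambda_s,\alpha_1)}{t_i^{(1)}-z_s}-\sum_{j=1,\,j\neq i}^{l_1}\frac{2}{t_i^{(1)}-t_j^{(1)}}+\sum_{j=1}^{l_2}\frac{1}{t_i^{(1)}-t_j^{(2)}}=0,\qquad i=1,\dots,l_1,$$ $$\sum_{s=1}^{n}\frac{(\Lambda_s,\alpha_2)}{t_i^{(2)}-z_s}-\sum_{j=1,\,j\neq i}^{l_2}\frac{2}{t_i^{(2)}-t_j^{(2)}}+\sum_{j=1}^{l_1}\frac{1}{t_i^{(2)}-t_j^{(1)}}=0,\qquad i=1,\d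ots,l_2.$$
   Context: **Gaudin model.** $\mathfrak{sl}_3$ has generators $e_{a,b}$ ($a\ne b$), $h_1=e_{1,1}-e_{2,2}$, $h_2=e_{2,2}-e_{3,3}$; $\mathfrak h$ is the Cartan subalgebra; $(\cdot,\cdot)$ is the invariant scalar product with $(h_i,h_i)=2$ (also on $\mathfrak h^*$); $\alpha_1,\alpha_2$ are the simple roots; $\Omega=\sum_i x_i\otimes x_i$, $(x_i)$ an orthonormal basis of $\mathfrak{sl}_3$, is the Casimir element. $M_\Lambda$ is the Verma module with highest weight $\Lambda$ and highest weight vector $v_\Lambda$. The Gaudin Hamiltonians are the operators $H_i(\boldsymbol z)=\sum_{j\ne i}\Omega^{(ij)}/(z_i-z_j)$ on $M_{\Lambda_1}\otimes\dots\otimes M_{\Lambda_n}$, where $\Omega^{(ij)}$ is $\Omega$ acting in the $i$-th and $j$-th factors. **Canonical weight function.** Let $P(\boldsymbol l,n)$ be the set of collections $I=(i^j_{2,1},i^j_{3,1},i^j_{3,2})_{j=1,\dots,n}$ of nonnegative integers with $\sum_j(i^j_{2,1}+i^j_{3,1})=l_1$ and $\sum_j(i^j_{3,1}+i^j_{3,2})=l_2$. For $I\in P(\boldsymbol l,n)$ let $S(I)=\{(j,a,b,q): 1\le j\le n,\ 1\le b<a\le3,\ 1\le q\le i^j_{a,b}\}$, let $S_1(I)\subset S(I)$ consist of elements with $b=1$ and $S_2(I)$ of elements with $a=3$ (so $|S_i(I)|=l_i$), and let $B(I)$ be the set of pairs $\beta=(\beta_1,\beta_2)$ of bijections $\beta_i:S_i(I)\to\{1,\dots,l_i\}$.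 For $s=(j,a,b,q)$ put $\omega_{s,\beta}=\dfrac{1}{t^{(1)}_{\beta_1(s)}-z_j}$ if $(a,b)=(2,1)$; $\omega_{s,\beta}=\dfrac{1}{t^{(2)}_{\beta_2(s)}-z_j}$ if $(a,b)=(3,2)$; $\omega_{s,\beta}=\dfrac1{(t^{(1)}_{\beta_1(s)}-z_j)(t^{(2)}_{\beta_2(s)}-t^{(1)}_{\beta_1(s)})}$ if $(a,b)=(3,1)$. Put $\omega_I=\dfrac{1}{\prod_{j}\prod_{a>b}(i^j_{a,b})!}\sum_{\beta\in B(I)}\prod_{s\in S(I)}\omega_{s,\beta}$ and $$\omega_{\boldsymbol l,n}(\boldsymbol t,\boldsymbol z)=\sum_{I\in P(\boldsymbol l,n)}\omega_I\,\bigotimes_{j=1}^n e_{2,1}^{i^j_{2,1}}e_{3,1}^{i^j_{3,1}}e_{3,2}^{i^j_{3,2}}v_{\Lambda_j}.$$ (In the paper this vector, written in the polynomial realization of the Verma modules and in separated variables $\boldsymbol u,\boldsymbol y$, is denoted $\Psi(\boldsymbol t,\boldsymbol z,\boldsymbol u,\boldsymbol y)$.) *)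

(* Defs.v *)
From HB Require Import structures.
From mathcomp Require Import all_boot all_order all_algebra.
From mathcomp Require Import boolp reals complex ring.

Set Implicit Arguments.
Unset Strict Implicit.
Unset Printing Implicit Defensive.

Import GRing.Theory.
Local Open Scope ring_scope.

(* The row and column labels 1, 2, 3 are the elements 0, 1, 2 of 'I_3.        *)
Definition ix1 : 'I_3 := @Ordinal 3 0 isT.
Definition ix2 : 'I_3 := @Ordinal 3 1 isT.
Definition ix3 : 'I_3 := @Ordinal 3 2 isT.

Definition sl3_space (K : fieldType) : {vspace 'M[K]_3} :=
  lker (linfun (mxtrace : 'M[K]_3 -> K^o)).

Lemma memv_sl3 (K : fieldType) (A : 'M[K]_3) :
  (A \in sl3_space K) = (\tr A == 0).
Proof. by rewrite memv_ker lfunE. Qed.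

Notation sl3 K := (subvs_of (sl3_space K)).

Fact sl3_bracket_subproof (K : fieldType) (A B : sl3 K) :
  vsval A *m vsval B - vsval B *m vsval A \in sl3_space K.
Proof. by rewrite memv_sl3 linearB /= mxtrace_mulC subrr. Qed.

Definition sl3_bracket (K : fieldType) (A B : sl3 K) : sl3 K :=
  Subvs (sl3_bracket_subproof A B).

(* vsproj is only a coercion into the subtype here, see vsval_e and vsval_h; *)
(* sl3_e K a a is meaningless and never used.                                 *)
Definition sl3_e (K : fieldType) (a b : 'I_3) : sl3 K :=
  vsproj (sl3_space K) (delta_mx a b).

Definition sl3_h (K : fieldType) (a b : 'I_3) : sl3 K :=
  vsproj (sl3_space K) (delta_mx a a - delta_mx b b).

Lemma vsval_e (K : fieldType) (a b : 'I_3) :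
  a != b -> vsval (sl3_e K a b) = delta_mx a b.
Proof.
move=> ab; apply: vsprojK; rewrite memv_sl3 /mxtrace big1 // => i _.
by rewrite mxE; case: (i =P a) => //= ->; rewrite (negPf ab).
Qed.

Lemma vsval_h (K : fieldType) (a b : 'I_3) :
  vsval (sl3_h K a b) = delta_mx a a - delta_mx b b.
Proof.
apply: vsprojK; rewrite memv_sl3 linearB /= /mxtrace.
rewrite (bigD1 a) //= big1 => [|i ia]; last by rewrite mxE (negPf ia).
rewrite (bigD1 b) //= big1 => [|i ib]; last by rewrite mxE (negPf ib).
by rewrite !mxE !eqxx !addr0 subrr.
Qed.

Definition h1 (K : fieldType) : sl3 K := sl3_h K ix1 ix2.
Definition h2 (K : fieldType) : sl3 K := sl3_h K ix2 ix3.

(* The trace form of the defining representation is the invariant form        *)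
(* normalized by (h_i, h_i) = 2.                                              *)
Definition sl3_form (K : fieldType) (A B : sl3 K) : K :=
  \tr (vsval A *m vsval B).

Definition orthonormal_basis (K : fieldType) (x : 8.-tuple (sl3 K)) : Prop :=
  basis_of fullv x /\
  forall i j : 'I_8, sl3_form (tnth x i) (tnth x j) = (i == j)%:R.

Definition cartan_space (K : fieldType) : {vspace sl3 K} :=
  <<[:: h1 K; h2 K]>>%VS.

Notation cartan K := (subvs_of (cartan_space K)).

Notation weight K := 'Hom(cartan K, K^o).

Definition ch1 (K : fieldType) : cartan K := vsproj (cartan_space K) (h1 K).
Definition ch2 (K : fieldType) : cartan K := vsproj (cartan_space K) (h2 K).

Lemma vsval_ch1 (K : fieldType) : vsval (ch1 K) = h1 K.
Proof. by apply: vsprojK; rewrite memv_span // inE eqxx. Qed.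

Lemma vsval_ch2 (K : fieldType) : vsval (ch2 K) = h2 K.
Proof. by apply: vsprojK; rewrite memv_span // !inE eqxx orbT. Qed.

Definition root_fun (K : fieldType) (a b : 'I_3) (h : cartan K) : K^o :=
  vsval (vsval h) a a - vsval (vsval h) b b.

Fact root_fun_linear (K : fieldType) (a b : 'I_3) : linear (@root_fun K a b).
Proof.
move=> c g h; rewrite /root_fun !linearP /= !mxE.
by rewrite scalerBr addrACA opprD.
Qed.

HB.instance Definition _ (K : fieldType) (a b : 'I_3) :=
  GRing.isLinear.Build K (cartan K) K^o _ (@root_fun K a b)
    (@root_fun_linear K a b).

Definition alpha1 (K : fieldType) : weight K := linfun (@root_fun K ix1 ix2).
Definition alpha2 (K : fieldType) : weight K := linfun (@root_fun K ix2 ix3).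

(* The element of the Cartan subalgebra representing a weight through the     *)
(* form (see riesz_form); the coefficients are those of the inverse Cartan    *)
(* matrix.                                                                    *)
Definition riesz (K : fieldType) (lam : weight K) : cartan K :=
  let m1 : K := lam (ch1 K) in let m2 : K := lam (ch2 K) in
  ((2%:R * m1 + m2) / 3%:R) *: ch1 K + ((m1 + 2%:R * m2) / 3%:R) *: ch2 K.

Definition weight_form (K : fieldType) (lam mu : weight K) : K :=
  sl3_form (vsval (riesz lam)) (vsval (riesz mu)).

Lemma tr_diag_mul (K : fieldType) (a b : 'I_3) :
  \tr ((delta_mx a a : 'M[K]_3) *m delta_mx b b) = (a == b)%:R.
Proof.
rewrite mul_delta_mx_cond linearMn /= /mxtrace (bigD1 a) //= big1 => [|i ia].
  by rewrite mxE eqxx /= addr0; case: eqP.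
by rewrite mxE (negPf ia).
Qed.

Lemma sl3_formDl (K : fieldType) (B : sl3 K) c (A A' : sl3 K) :
  sl3_form (c *: A + A') B = c * sl3_form A B + sl3_form A' B.
Proof. by rewrite /sl3_form linearP /= mulmxDl -scalemxAl linearP. Qed.

Lemma sl3_formZl (K : fieldType) (B : sl3 K) c (A : sl3 K) :
  sl3_form (c *: A) B = c * sl3_form A B.
Proof. by rewrite /sl3_form linearZ /= -scalemxAl linearZ. Qed.

Lemma sl3_formC (K : fieldType) (A B : sl3 K) : sl3_form A B = sl3_form B A.
Proof. exact: mxtrace_mulC. Qed.

Lemma sl3_form_h (K : fieldType) (a b c d : 'I_3) :
  sl3_form (sl3_h K a b) (sl3_h K c d)
  = (a == c)%:R - (a == d)%:R - (b == c)%:R + (b == d)%:R.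
Proof.
rewrite /sl3_form !vsval_h mulmxBl !mulmxBr !linearB /= !tr_diag_mul.
by ring.
Qed.

Lemma cartan_coord (K : fieldType) (h : cartan K) :
  exists c d : K, h = c *: ch1 K + d *: ch2 K.
Proof.
have: vsval h \in (<[h1 K]> + <[h2 K]>)%VS.
  by have := subvsP h; rewrite {2}/cartan_space span_cons span_seq1.
case/memv_addP => _ /vlineP[c ->] [_ /vlineP[d ->] E].
exists c, d; apply: subvs_inj.
by rewrite E linearD !linearZ /= vsval_ch1 vsval_ch2.
Qed.

Lemma riesz_form (K : fieldType) (lam : weight K) (h : cartan K) :
  (3%:R : K) != 0 -> sl3_form (vsval (riesz lam)) (vsval h) = lam h.
Proof.
move=> K3; have [c [d ->]] := cartan_coord h.
rewrite /riesz !linearP !linearZ /= vsval_ch1 vsval_ch2.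
rewrite sl3_formDl ![sl3_form (_ *: _) _]sl3_formZl.
rewrite ![sl3_form _ (c *: _ + _)]sl3_formC !sl3_formDl !sl3_formZl.
rewrite !sl3_form_h /=.
rewrite /GRing.scale /=; field; exact: K3.
Qed.

Record sl3_module (K : fieldType) := Sl3Module {
  sl3_carrier :> lmodType K;
  act : sl3 K -> {linear sl3_carrier -> sl3_carrier};
  act_linear : forall c (A B : sl3 K) (v : sl3_carrier),
    act (c *: A + B) v = c *: act A v + act B v;
  act_bracket : forall (A B : sl3 K) (v : sl3_carrier),
    act (sl3_bracket A B) v = act A (act B v) - act B (act A v)
}.

Definition sl3_hom (K : fieldType) (V W : sl3_module K)
    (f : {linear V -> W}) : Prop :=
  forall (A : sl3 K) (v : V), f (act V A v) = act W A (f v).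

Definition is_highest_weight (K : fieldType) (lam : weight K)
    (V : sl3_module K) (v : V) : Prop :=
  (forall a b : 'I_3, (a < b)%N -> act V (sl3_e K a b) v = 0) /\
  (forall h : cartan K, act V (vsval h) v = lam h *: v).

(* M_lam = U(sl_3) (x)_{U(b)} K_lam, characterized by its universal property. *)
Record verma_module (K : fieldType) (lam : weight K) := VermaModule {
  verma_carrier :> sl3_module K;
  verma_vec : verma_carrier;
  verma_highest_weight : is_highest_weight lam verma_vec;
  verma_universal : forall (W : sl3_module K) (w : W),
    is_highest_weight lam w ->
    exists f : {linear verma_carrier -> W},
      [/\ sl3_hom f, f verma_vec = w
        & forall g : {linear verma_carrier -> W},
            sl3_hom g -> g verma_vec = w -> g =1 f]
}.

(* dfwith m u is the family m with its j-th entry replaced by u : M j.        *)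
Definition multilinear (K : fieldType) (n : nat) (M : 'I_n -> lmodType K)
    (W : lmodType K) (f : (forall j, M j) -> W) : Prop :=
  forall (m : forall j, M j) (j : 'I_n) (c : K) (u v : M j),
    f (dfwith m (c *: u + v)) = c *: f (dfwith m u) + f (dfwith m v).

Record tensor_product (K : fieldType) (n : nat) (M : 'I_n -> lmodType K) :=
TensorProduct {
  tensor_carrier :> lmodType K;
  tensor : (forall j, M j) -> tensor_carrier;
  tensor_multilinear : multilinear tensor;
  tensor_lift : forall (W : lmodType K) (f : (forall j, M j) -> W),
    multilinear f -> {linear tensor_carrier -> W};
  tensor_liftE : forall (W : lmodType K) (f : (forall j, M j) -> W)
    (fP : multilinear f) (m : forall j, M j), tensor_lift fP (tensor m) = f m;
  tensor_ext : forall (W : lmodType K) (f g : {linear tensor_carrier -> W}),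
    (forall m : forall j, M j, f (tensor m) = g (tensor m)) -> f =1 g
}.

Section Gaudin.
Context (K : fieldType) (n : nat) (M : 'I_n -> sl3_module K).
Context (T : tensor_product M).

Definition act_tensor (j : 'I_n) (A : sl3 K) (m : forall j, M j) : T :=
  tensor T (dfwith m (act (M j) A (m j))).

Lemma dfwith_dfwith (m : forall j, M j) (j : 'I_n) (u v : M j) :
  dfwith (dfwith m u) v = dfwith m v.
Proof.
apply: functional_extensionality_dep => i.
have [<-|ji] := eqVneq j i; first by rewrite !dfwith_in.
by rewrite !dfwith_out.
Qed.

Lemma dfwithC (m : forall j, M j) (i j : 'I_n) (u : M i) (v : M j) :
  i != j -> dfwith (dfwith m u) v = dfwith (dfwith m v) u.
Proof.
move=> ij; apply: functional_extensionality_dep => k.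
have [jk|jk] := eqVneq j k.
  by move: v; case: k / jk => v; rewrite dfwith_in dfwith_out // dfwith_in.
rewrite dfwith_out //.
have [ik|ik] := eqVneq i k.
  by move: u; case: k / ik jk => _ u; rewrite !dfwith_in.
by rewrite !dfwith_out.
Qed.

Lemma act_tensor_multilinear (j : 'I_n) (A : sl3 K) :
  multilinear (act_tensor j A).
Proof.
move=> m i c u v; rewrite /act_tensor.
have [ij|ij] := eqVneq i j.
  case: j / ij; rewrite !dfwith_in !dfwith_dfwith linearP.
  exact: tensor_multilinear.
rewrite !dfwith_out // !(dfwithC _ _ _ ij).
exact: tensor_multilinear.
Qed.

(* The operator on the tensor product acting by A in the j-th factor.         *)
Definition factor_act (j : 'I_n) (A : sl3 K) : {linear T -> T} :=
  tensor_lift T (act_tensor_multilinear j A).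

Lemma factor_actE (j : 'I_n) (A : sl3 K) (m : forall j, M j) :
  factor_act j A (tensor T m) = tensor T (dfwith m (act (M j) A (m j))).
Proof. exact: tensor_liftE. Qed.

Definition casimir (x : 8.-tuple (sl3 K)) (i j : 'I_n) (w : T) : T :=
  \sum_(k < 8) factor_act i (tnth x k) (factor_act j (tnth x k) w).

Definition gaudin (x : 8.-tuple (sl3 K)) (z : 'I_n -> K) (i : 'I_n) (w : T) : T :=
  \sum_(j < n | j != i) (z i - z j)^-1 *: casimir x i j w.

End Gaudin.

Definition eigenvector (K : fieldType) (V : lmodType K) (f : V -> V) (v : V) :=
  v != 0 /\ exists mu : K, f v = mu *: v.

(* The pairs (a, b) with b < a.                                               *)
Definition pos_root := {ab : 'I_3 * 'I_3 | (ab.2 < ab.1)%N}.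
Definition r21 : pos_root := exist _ (ix2, ix1) isT.
Definition r31 : pos_root := exist _ (ix3, ix1) isT.
Definition r32 : pos_root := exist _ (ix3, ix2) isT.

Section WeightFunction.
Context (K : fieldType) (n l1 l2 : nat).
Context (z : 'I_n -> K) (t1 : 'I_l1 -> K) (t2 : 'I_l2 -> K).

(* A collection I assigns i^j_{a,b} to (j, (a, b)); the constraints defining  *)
(* P(l, n) bound all the i^j_{a,b} by l1 + l2, which makes the type finite.   *)
Definition collection := {ffun 'I_n * pos_root -> 'I_(l1 + l2).+1}.

Definition in_P (I : collection) : bool :=
  (\sum_(j < n) (I (j, r21) + I (j, r31)) == l1)%N &&
  (\sum_(j < n) (I (j, r31) + I (j, r32)) == l2)%N.

(* S(I): the quadruple (j, a, b, q) is Tagged _ q with tag (j, (a, b)).       *)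
Definition S_ (I : collection) := {x : 'I_n * pos_root & 'I_(I x)}.

Definition S_site (I : collection) (s : S_ I) : 'I_n := (tag s).1.
Definition S_root (I : collection) (s : S_ I) : pos_root := (tag s).2.

Definition S1 (I : collection) :=
  {s : S_ I | (val (S_root s)).2 == ix1}.
Definition S2 (I : collection) :=
  {s : S_ I | (val (S_root s)).1 == ix3}.

Definition bijectiveb (A B : finType) (f : {ffun A -> B}) : bool :=
  injectiveb f && [forall y, y \in codom f].

Definition in_B (I : collection)
    (beta : {ffun S1 I -> 'I_l1} * {ffun S2 I -> 'I_l2}) : bool :=
  bijectiveb beta.1 && bijectiveb beta.2.

(* t_{beta(s)} for s in S_1(I) (resp. S_2(I)); the value 0 elsewhere is never *)
(* used.                                                                      *)
Definition t1_at (I : collection) (beta1 : {ffun S1 I -> 'I_l1}) (s : S_ I) : K :=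
  if insub s is Some s1 then t1 (beta1 s1) else 0.
Definition t2_at (I : collection) (beta2 : {ffun S2 I -> 'I_l2}) (s : S_ I) : K :=
  if insub s is Some s2 then t2 (beta2 s2) else 0.

Definition omega_s (I : collection)
    (beta : {ffun S1 I -> 'I_l1} * {ffun S2 I -> 'I_l2}) (s : S_ I) : K :=
  let zj := z (S_site s) in
  if S_root s == r21 then (t1_at beta.1 s - zj)^-1
  else if S_root s == r32 then (t2_at beta.2 s - zj)^-1
  else ((t1_at beta.1 s - zj) * (t2_at beta.2 s - t1_at beta.1 s))^-1.

Definition omega_I (I : collection) : K :=
  ((\prod_x (I x)`!)%N%:R)^-1 *
  \sum_(beta : {ffun S1 I -> 'I_l1} * {ffun S2 I -> 'I_l2} | in_B beta)
    \prod_(s : S_ I) omega_s beta s.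

Context (Lambda : 'I_n -> weight K) (M : forall j, verma_module (Lambda j)).

Definition pbw_vec (I : collection) (j : 'I_n) : M j :=
  iter (I (j, r21)) (act (M j) (sl3_e K ix2 ix1))
    (iter (I (j, r31)) (act (M j) (sl3_e K ix3 ix1))
      (iter (I (j, r32)) (act (M j) (sl3_e K ix3 ix2)) (verma_vec (M j)))).

Definition weight_function (T : tensor_product (fun j => M j)) : T :=
  \sum_(I : collection | in_P I) omega_I I *: tensor T (pbw_vec I).

End WeightFunction.

(* Main.v *)
(* Write E_ab(u) = sum_s e_ab^(s) / (u - z_s), and let phi be the functional   *)
(* on the tensor product with phi o e_21^(s) = x_s phi, phi o e_32^(s) =        *)
(* y_s phi and phi o e_31^(s) = 0 (a Whittaker functional).  The weight         *)
(* function omega satisfies, for each variable t = t1_i,                        *)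
(*   omega = E_21(t) omega' + sum_j (t2_j - t)^-1 E_31(t) omega''_j,            *)
(* where omega' omits t and omega''_j omits t and t2_j, and similarly for each  *)
(* t2_j.  As n >= 2, the x_s can be chosen so that sum_s x_s / (u - z_s)        *)
(* vanishes at u = t but at no other variable.  Then phi annihilates the images *)
(* of E_21(t) and E_31(t), hence omega and, by the eigenvector property,        *)
(* H_s omega.  So phi(H_s omega) = 0 involves only the commutators of H_s with  *)
(* E_21(t) and E_31(t), and it equals a nonzero multiple of the left-hand side  *)
(* of the Bethe equation of t.                                                  *)

(* The functional phi comes from the universal property of Verma modules. The algebra sl_3 acts by
   differential operators on functions of three variables x, w, y, with e_21 and e_31 acting as
   multiplication by x and w. Evaluating the image of M at a point with w = 0 gives
   [whittaker_functional], and the product over the sites is [tensor_whittaker].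

   The symmetrized sum with factorials in the weight function is a sum over exact covers of the set
   of variables ([omega_I_cover], [weight_functionE]). Removing the node that contains a given
   variable yields the recursions [Omega_t1] and [Omega_t2]. Under phi they make omega a product of
   the numbers F i and G j, the values of sum_s x_s / (u - z_s) at t1_i and of sum_s y_s / (u - z_s)
   at t2_j ([phi_Om1], [phi_Om2]). If F i = 0 for a single variable t = t1_i, then phi(omega) = 0,
   while phi(omega') is nonzero.

   The Casimir element commutes with the diagonal action, so its commutators with A acting at the
   sites s and r are opposite ([phi_casimir_e21], [phi_casimir_e32], [phi_casimir_e31]). Hence
   phi(H_s E_A(t) v) reduces to one sum over r ([phi_gaudin_current]). For A = e_21 that sum
   contains the values phi(h_1^(r) omega'), which [phi_cartan_Om] computes. Partial fractions in
   [bethe_sum] turn them into the Bethe expression plus a term with sum_s y_s / (t - z_s), and the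
   E_31 part of omega cancels this term. The variables t2_j are treated in the same way with e_32,
   h_2 and the roles of x and y exchanged. *)
Require Import Defs.
From HB Require Import structures.
From mathcomp Require Import all_boot all_order all_algebra.
From mathcomp Require Import boolp reals complex ring zify.

Set Implicit Arguments.
Unset Strict Implicit.
Unset Printing Implicit Defensive.

Import GRing.Theory Num.Theory.
Local Open Scope ring_scope.

(** * Whittaker functionals on Verma modules *)

Section Jets.
Context (K : fieldType) (x0 y0 m1 m2 : K).

(* jv p a b c is the value at (x0, 0, y0) of the derivative of order (a, b, c)  *)
(* of a function p(x, w, y), where x^a w^b y^c stands for the vector            *)
(* e_21^a e_31^b e_32^c v of the Verma module.  With the base point shifted in  *)
(* this way, the Whittaker functional is just jv p 0 0 0.                       *)
Record jet := Jet { jv : nat -> nat -> nat -> K }.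

Lemma jetP (p q : jet) : (forall a b c, jv p a b c = jv q a b c) -> p = q.
Proof.
case: p q => [p] [q] /= pq; congr Jet; do 3![apply/funext => ?]; exact: pq.
Qed.

HB.instance Definition _ := gen_eqMixin jet.
HB.instance Definition _ := gen_choiceMixin jet.

Definition jet0 := Jet (fun _ _ _ => 0).
Definition jetD p q := Jet (fun a b c => jv p a b c + jv q a b c).
Definition jetN p := Jet (fun a b c => - jv p a b c).
Definition jetZ k p := Jet (fun a b c => k * jv p a b c).

Ltac jr := repeat move=> ?; apply: jetP => ? ? ? /=; ring.
Fact jetA : associative jetD. Proof. jr. Qed.
Fact jetC : commutative jetD. Proof. jr. Qed.
Fact jet0D : left_id jet0 jetD. Proof. jr. Qed.
Fact jetND : left_inverse jet0 jetN jetD. Proof. jr. Qed.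
HB.instance Definition _ := GRing.isZmodule.Build jet jetA jetC jet0D jetND.
Fact jetZA a b p : jetZ a (jetZ b p) = jetZ (a * b) p. Proof. jr. Qed.
Fact jetZ1 : left_id 1 jetZ. Proof. jr. Qed.
Fact jetZDr : right_distributive jetZ +%R. Proof. jr. Qed.
Fact jetZDl v : {morph jetZ^~ v : a b / a + b}. Proof. jr. Qed.
HB.instance Definition _ :=
  GRing.Zmodule_isLmodule.Build K jet jetZA jetZ1 jetZDr jetZDl.

Lemma jetDE (p q : jet) a b c : jv (p + q) a b c = jv p a b c + jv q a b c.
Proof. by []. Qed.
Lemma jetNE (p : jet) a b c : jv (- p) a b c = - jv p a b c.
Proof. by []. Qed.
Lemma jetZE k (p : jet) a b c : jv (k *: p) a b c = k * jv p a b c.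
Proof. by []. Qed.
Definition jetE := (jetDE, jetNE, jetZE).

Definition Dx (p : jet) : jet := Jet (fun a b c => jv p a.+1 b c).
Definition Dw (p : jet) : jet := Jet (fun a b c => jv p a b.+1 c).
Definition Dy (p : jet) : jet := Jet (fun a b c => jv p a b c.+1).
Definition Mx (p : jet) : jet := Jet (fun a b c => x0 * jv p a b c + a%:R * jv p a.-1 b c).
Definition Mw (p : jet) : jet := Jet (fun a b c => b%:R * jv p a b.-1 c).
Definition My (p : jet) : jet := Jet (fun a b c => y0 * jv p a b c + c%:R * jv p a b c.-1).

Ltac lin := move=> k p q; apply: jetP => a b c; rewrite /= ?mulr0; ring.
Fact Dx_linear : linear Dx. Proof. by []. Qed.
Fact Dw_linear : linear Dw. Proof. by []. Qed.
Fact Dy_linear : linear Dy. Proof. by []. Qed.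
Fact Mx_linear : linear Mx. Proof. lin. Qed.
Fact Mw_linear : linear Mw. Proof. lin. Qed.
Fact My_linear : linear My. Proof. lin. Qed.
HB.instance Definition _ := GRing.isLinear.Build K jet jet _ Dx Dx_linear.
HB.instance Definition _ := GRing.isLinear.Build K jet jet _ Dw Dw_linear.
HB.instance Definition _ := GRing.isLinear.Build K jet jet _ Dy Dy_linear.
HB.instance Definition _ := GRing.isLinear.Build K jet jet _ Mx Mx_linear.
HB.instance Definition _ := GRing.isLinear.Build K jet jet _ Mw Mw_linear.
HB.instance Definition _ := GRing.isLinear.Build K jet jet _ My My_linear.

Lemma DxMx p : Dx (Mx p) = Mx (Dx p) + p.
Proof.
apply: jetP => -[|a] b c; rewrite /=; ring.
Qed.
Lemma DwMw p : Dw (Mw p) = Mw (Dw p) + p.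
Proof.
apply: jetP => a [|b] c; rewrite /=; ring.
Qed.
Lemma DyMy p : Dy (My p) = My (Dy p) + p.
Proof.
apply: jetP => a b [|c]; rewrite /=; ring.
Qed.
Lemma DxMw p : Dx (Mw p) = Mw (Dx p). Proof. by []. Qed.
Lemma DxMy p : Dx (My p) = My (Dx p). Proof. by []. Qed.
Lemma DwMx p : Dw (Mx p) = Mx (Dw p). Proof. by []. Qed.
Lemma DwMy p : Dw (My p) = My (Dw p). Proof. by []. Qed.
Lemma DyMx p : Dy (Mx p) = Mx (Dy p). Proof. by []. Qed.
Lemma DyMw p : Dy (Mw p) = Mw (Dy p). Proof. by []. Qed.
Lemma DwDx p : Dw (Dx p) = Dx (Dw p). Proof. by []. Qed.
Lemma DyDx p : Dy (Dx p) = Dx (Dy p). Proof. by []. Qed.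
Lemma DyDw p : Dy (Dw p) = Dw (Dy p). Proof. by []. Qed.
Lemma MwMx p : Mw (Mx p) = Mx (Mw p).
Proof. by apply: jetP => a b c; rewrite /=; ring. Qed.
Lemma MyMx p : My (Mx p) = Mx (My p).
Proof. by apply: jetP => a b c; rewrite /=; ring. Qed.
Lemma MyMw p : My (Mw p) = Mw (My p).
Proof. by apply: jetP => a b c; rewrite /=; ring. Qed.

(** Normal ordering in the Weyl algebra: multiplications to the left of derivatives, and each kind
    in the order x, w, y. Equal operators thus become sums of the same terms, which [ring] can
    compare. *)
Definition weyl := (DxMx, DwMw, DyMy, (DxMw, DxMy, DwMx, DwMy, DyMx, DyMw),
  (DwDx, DyDx, DyDw), (MwMx, MyMx, MyMw)).

Lemma DxE : ((forall p q, Dx (p + q) = Dx p + Dx q)%R *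
  (forall p, Dx (- p) = - Dx p)%R *
  (forall k p, Dx (k *: p) = k *: Dx p)%R)%type.
Proof. by do !split=> *; rewrite (linearD, linearN, linearZ). Qed.
Lemma DwE : ((forall p q, Dw (p + q) = Dw p + Dw q)%R *
  (forall p, Dw (- p) = - Dw p)%R *
  (forall k p, Dw (k *: p) = k *: Dw p)%R)%type.
Proof. by do !split=> *; rewrite (linearD, linearN, linearZ). Qed.
Lemma DyE : ((forall p q, Dy (p + q) = Dy p + Dy q)%R *
  (forall p, Dy (- p) = - Dy p)%R *
  (forall k p, Dy (k *: p) = k *: Dy p)%R)%type.
Proof. by do !split=> *; rewrite (linearD, linearN, linearZ). Qed.
Lemma MxE : ((forall p q, Mx (p + q) = Mx p + Mx q)%R *
  (forall p, Mx (- p) = - Mx p)%R *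
  (forall k p, Mx (k *: p) = k *: Mx p)%R)%type.
Proof. by do !split=> *; rewrite (linearD, linearN, linearZ). Qed.
Lemma MwE : ((forall p q, Mw (p + q) = Mw p + Mw q)%R *
  (forall p, Mw (- p) = - Mw p)%R *
  (forall k p, Mw (k *: p) = k *: Mw p)%R)%type.
Proof. by do !split=> *; rewrite (linearD, linearN, linearZ). Qed.
Lemma MyE : ((forall p q, My (p + q) = My p + My q)%R *
  (forall p, My (- p) = - My p)%R *
  (forall k p, My (k *: p) = k *: My p)%R)%type.
Proof. by do !split=> *; rewrite (linearD, linearN, linearZ). Qed.
Definition opE := (DxE, DwE, DyE, MxE, MwE, MyE).

#[local] Opaque Dx Dw Dy Mx Mw My.

(* The differential operators in x, w, y describing the action of the matrix    *)
(* unit with 0-based indices (i, j) on the vectors e_21^a e_31^b e_32^c v; the   *)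
(* action is extended to gl_3 by letting e_33 annihilate v.                     *)
Definition jet_e (i j : nat) (p : jet) : jet :=
  match i, j with
  | 0, 0 => (m1 + m2) *: p - Mx (Dx p) - Mw (Dw p)
  | 1, 1 => m2 *: p + Mx (Dx p) - My (Dy p)
  | 2, 2 => Mw (Dw p) + My (Dy p)
  | 1, 0 => Mx p
  | 2, 0 => Mw p
  | 2, 1 => My p + Mw (Dx p)
  | 0, 1 => m1 *: Dx p - Mw (Dw (Dx p)) + My (Dy (Dx p)) - Mx (Dx (Dx p))
            - My (Dw p)
  | 1, 2 => Mx (Dw p) + m2 *: Dy p - My (Dy (Dy p))
  | 0, 2 => (m1 + m2) *: Dw p - My (Dy (Dw p)) - Mw (Dw (Dw p)) - Mx (Dx (Dw p))
            - m2 *: Dx (Dy p) + My (Dx (Dy (Dy p)))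
  | _, _ => 0
  end.

Fact jet_e_linear i j : linear (jet_e i j).
Proof.
move=> k p q; apply: jetP => a b c.
case: i j => [|[|[|i]]] [|[|[|j]]] /=; rewrite ?linearP /= ?(linearP, jetE) //=; ring.
Qed.
HB.instance Definition _ i j :=
  GRing.isLinear.Build K jet jet _ (jet_e i j) (jet_e_linear i j).

(** The identity is antisymmetric under exchange of the two matrix units, so it is checked by normal
    ordering on ordered pairs only; [jet_e_bracket] deduces the rest. *)
Lemma jet_e_bracket_lt (i j k l : nat) p :
  (i < 3)%N -> (j < 3)%N -> (k < 3)%N -> (l < 3)%N ->
  (i * 3 + j < k * 3 + l)%N ->
  jet_e i j (jet_e k l p) - jet_e k l (jet_e i j p) =
  (j == k)%:R *: jet_e i l p - (l == i)%:R *: jet_e k j p.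
Proof.
case: i j k l => [|[|[|i]]] [|[|[|j]]] // [|[|[|k]]] [|[|[|l]]] // _ _ _ _ // _;
apply: jetP => a b c; rewrite /jet_e ?jetE ?opE ?weyl ?opE ?weyl ?opE ?jetE /=; ring.
Qed.

Lemma jet_e_bracket (i j k l : 'I_3) p :
  jet_e i j (jet_e k l p) - jet_e k l (jet_e i j p) =
  (j == k)%:R *: jet_e i l p - (l == i)%:R *: jet_e k j p.
Proof.
have [ijkl|klij|ijkl] := ltngtP (i * 3 + j) (k * 3 + l).
- exact: jet_e_bracket_lt.
- by rewrite -[LHS]opprB jet_e_bracket_lt // opprB.
- have [-> ->] : i = k /\ j = l; last by rewrite !subrr.
  by split; apply: val_inj; move: (ltn_ord i) (ltn_ord j) (ltn_ord k) (ltn_ord l) ijkl;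
    rewrite /=; lia.
Qed.
End Jets.

(** * The sl_3-module of jets and the functional it induces *)

Section JetModule.
Context (K : fieldType) (x0 y0 m1 m2 : K).
Notation jet_e := (jet_e x0 y0 m1 m2).
Notation jet := (jet K).

Definition jet_act (A : sl3 K) (p : jet) : jet :=
  \sum_i \sum_j vsval A i j *: jet_e i j p.

Fact jet_act_is_linear A : linear (jet_act A).
Proof.
move=> k p q; rewrite /jet_act scaler_sumr -big_split /=; apply: eq_bigr => i _.
rewrite scaler_sumr -big_split /=; apply: eq_bigr => j _.
by rewrite linearP scalerDr !scalerA mulrC.
Qed.
HB.instance Definition _ A :=
  GRing.isLinear.Build K jet jet _ (jet_act A) (jet_act_is_linear A).

Fact jet_act_linear c A B p :
  jet_act (c *: A + B) p = c *: jet_act A p + jet_act B p.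
Proof.
rewrite /jet_act scaler_sumr -big_split /=; apply: eq_bigr => i _.
rewrite scaler_sumr -big_split /=; apply: eq_bigr => j _.
by rewrite !mxE scalerDl scalerA.
Qed.

(** Both compositions are expanded over pairs of matrix units. The Kronecker deltas of
    [jet_e_bracket] then contract the inner index, which produces the entries of the two matrix
    products. *)
Fact jet_act_bracket A B p :
  jet_act (sl3_bracket A B) p = jet_act A (jet_act B p) - jet_act B (jet_act A p).
Proof.
pose F i j k l : jet := (vsval A i j * vsval B k l) *: jet_e i j (jet_e k l p).
pose G i j k l : jet := (vsval A i j * vsval B k l) *: jet_e k l (jet_e i j p).
have ->: jet_act A (jet_act B p) = \sum_i \sum_j \sum_k \sum_l F i j k l.
  rewrite {1}/jet_act; apply: eq_bigr => i _; apply: eq_bigr => j _.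
  rewrite /jet_act linear_sum scaler_sumr; apply: eq_bigr => k _.
  rewrite linear_sum scaler_sumr; apply: eq_bigr => l _.
  by rewrite linearZ /= scalerA.
have ->: jet_act B (jet_act A p) = \sum_i \sum_j \sum_k \sum_l G i j k l.
  rewrite [RHS](eq_bigr (fun i => \sum_k \sum_j \sum_l G i j k l)); last first.
    by move=> i _; rewrite exchange_big.
  rewrite exchange_big /= {1}/jet_act; apply: eq_bigr => k _.
  transitivity (\sum_l \sum_i \sum_j G i j k l); last first.
    by rewrite exchange_big; apply: eq_bigr => i _; rewrite exchange_big.
  apply: eq_bigr => l _.
  rewrite /jet_act linear_sum scaler_sumr; apply: eq_bigr => i _.
  rewrite linear_sum scaler_sumr; apply: eq_bigr => j _.
  by rewrite linearZ /= scalerA /G mulrC.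
rewrite -sumrB.
transitivity (\sum_i \sum_j \sum_k \sum_l ((vsval A i j * vsval B k l) *:
   ((j == k)%:R *: jet_e i l p - (l == i)%:R *: jet_e k j p))); last first.
  do 3![apply: eq_bigr => ? _; rewrite -?sumrB].
  apply: eq_bigr => ? _.
  by rewrite /F /G -jet_e_bracket scalerBr.
pose F' i j k l : jet := (vsval A i j * vsval B k l) *: ((j == k)%:R *: jet_e i l p).
pose G' i j k l : jet := (vsval A i j * vsval B k l) *: ((l == i)%:R *: jet_e k j p).
transitivity (\sum_i \sum_j \sum_k \sum_l F' i j k l
  - \sum_i \sum_j \sum_k \sum_l G' i j k l); last first.
  do 4![rewrite -sumrB; apply: eq_bigr => ? _].
  by rewrite /F' /G' scalerBr.
have ->: \sum_i \sum_j \sum_k \sum_l F' i j k l =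
    \sum_i \sum_l (vsval A *m vsval B) i l *: jet_e i l p.
  apply: eq_bigr => i _; rewrite [RHS](eq_bigr (fun l =>
    \sum_j (vsval A i j * vsval B j l) *: jet_e i l p)); last first.
    by move=> l _; rewrite mxE scaler_suml.
  rewrite [RHS]exchange_big /=; apply: eq_bigr => j _.
  rewrite (bigD1 j) //= [X in _ + X]big1 ?addr0; last first.
    by move=> k kj; apply: big1 => l _; rewrite /F' eq_sym (negPf kj) scale0r scaler0.
  by apply: eq_bigr => l _; rewrite /F' eqxx scale1r.
have ->: \sum_i \sum_j \sum_k \sum_l G' i j k l =
    \sum_k \sum_j (vsval B *m vsval A) k j *: jet_e k j p.
  rewrite [RHS](eq_bigr (fun k =>
    \sum_j \sum_i (vsval B k i * vsval A i j) *: jet_e k j p)); last first.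
    by move=> k _; apply: eq_bigr => j _; rewrite mxE scaler_suml.
  rewrite [RHS](eq_bigr (fun k =>
    \sum_i \sum_j (vsval B k i * vsval A i j) *: jet_e k j p)); last first.
    by move=> k _; rewrite exchange_big.
  rewrite [RHS]exchange_big /=; apply: eq_bigr => i _.
  rewrite exchange_big /=; apply: eq_bigr => k _; apply: eq_bigr => j _.
  rewrite (bigD1 i) //= [X in _ + X]big1 ?addr0; last first.
    by move=> l li; rewrite /G' (negPf li) scale0r scaler0.
  by rewrite /G' eqxx scale1r mulrC.
rewrite -sumrB; apply: eq_bigr => i _; rewrite -sumrB; apply: eq_bigr => j _.
by rewrite /= !mxE scalerBl.
Qed.

Definition jet_module : sl3_module K :=
  Sl3Module jet_act_linear jet_act_bracket.

Lemma jet_act_e (a b : 'I_3) (p : jet) : a != b -> jet_act (sl3_e K a b) p = jet_e a b p.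
Proof.
move=> ab; rewrite /jet_act vsval_e // (bigD1 a) //= [X in _ + X]big1 ?addr0; last first.
  by move=> i ia; apply: big1 => j _; rewrite mxE (negPf ia) scale0r.
rewrite (bigD1 b) //= big1 ?addr0; last by move=> j jb; rewrite mxE (negPf jb) andbF scale0r.
by rewrite mxE !eqxx scale1r.
Qed.

Lemma jet_act_h (a b : 'I_3) (p : jet) :
  jet_act (sl3_h K a b) p = jet_e a a p - jet_e b b p.
Proof.
rewrite /jet_act vsval_h.
have E (c : 'I_3) : \sum_i \sum_j (delta_mx c c : 'M[K]_3) i j *: jet_e i j p = jet_e c c p.
  rewrite (bigD1 c) //= [X in _ + X]big1 ?addr0; last first.
    by move=> i ia; apply: big1 => j _; rewrite mxE (negPf ia) scale0r.
  rewrite (bigD1 c) //= big1 ?addr0; last by move=> j jb; rewrite mxE (negPf jb) andbF scale0r.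
  by rewrite mxE !eqxx scale1r.
rewrite -!E -sumrB; apply: eq_bigr => i _; rewrite -sumrB; apply: eq_bigr => j _.
by rewrite !mxE scalerBl.
Qed.

(** The jet of the constant function 1, which is to be the image of the highest weight vector. *)
Definition jet1 : jet := Jet (fun a b c => ((a == 0) && (b == 0) && (c == 0))%N%:R).

Lemma Dx1 : Dx jet1 = 0. Proof. exact: jetP. Qed.
Lemma Dw1 : Dw jet1 = 0. Proof. by apply: jetP => a b c; rewrite /= andbF. Qed.
Lemma Dy1 : Dy jet1 = 0. Proof. by apply: jetP => a b c; rewrite /= andbF. Qed.

Lemma jet1_highest_weight (lam : weight K) :
  lam (ch1 K) = m1 -> lam (ch2 K) = m2 -> is_highest_weight lam (jet1 : jet_module).
Proof.
move=> lam1 lam2; split=> [a b ab|h].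
  rewrite /= jet_act_e; last by rewrite -val_eqE ltn_eqF.
  by case: a b ab => [[|[|[|a]]] Ha] [[|[|[|b]]] Hb] //= _;
    rewrite ?(Dx1, Dw1, Dy1, linear0, scaler0, subr0, addr0).
have [c [d ->]] := cartan_coord h.
rewrite !linearP !linearZ /= vsval_ch1 vsval_ch2 lam1 lam2.
rewrite jet_act_linear -[d *: h2 K]addr0 jet_act_linear.
have ->: jet_act 0 jet1 = 0.
  by rewrite /jet_act; apply: big1 => i _; apply: big1 => j _; rewrite linear0 mxE scale0r.
rewrite addr0 !jet_act_h /= ?(Dx1, Dw1, Dy1, linear0, scaler0, subr0, addr0).
by rewrite scalerDl addrK scalerDl !scalerA.
Qed.
End JetModule.

(** The functional is the map to jets followed by evaluation at (x, 0, y). There the operators x and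
    w of e_21 and e_31 take the values x and 0, and y + w d/dx, by which e_32 acts, reduces to
    multiplication by y. *)
Lemma whittaker_functional (K : fieldType) (lam : weight K) (M : verma_module lam) (x y : K) :
  exists d : {linear M -> K^o}, [/\ d (verma_vec M) = 1,
   forall v, d (act M (sl3_e K ix2 ix1) v) = x * d v,
   forall v, d (act M (sl3_e K ix3 ix2) v) = y * d v
   & forall v, d (act M (sl3_e K ix3 ix1) v) = 0].
Proof.
have [f [fhom f1 _]] :=
  verma_universal M (jet1_highest_weight x y (erefl (lam (ch1 K))) (erefl (lam (ch2 K)))).
pose d (v : M) : K^o := jv (f v) 0 0 0.
have dlin : linear d by move=> k u v; rewrite /d linearP.
pose dL := GRing.isLinear.Build K M K^o _ d dlin.
pose D : {linear M -> K^o} := HB.pack d dL.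
exists D; split=> [|v|v|v]; rewrite /= /d ?fhom ?f1 //= jet_act_e //=.
- by rewrite mul0r addr0.
- by rewrite /= !mul0r !addr0.
- by rewrite mul0r.
Qed.

(** * The weight function as a sum over exact covers *)

Section ExactCover.
Context (E X : finType) (tok : E -> {set X}).

(* The token sets of the elements of D are nonempty and partition L. *)
Definition exact_cover (L : {set X}) (D : {set E}) : bool :=
  [forall k, #|[set e in D | k \in tok e]| == (k \in L)] &&
  [forall e in D, tok e != set0].

Lemma exact_cover_uniq L (D : {set E}) k e e' : exact_cover L D ->
  e \in D -> e' \in D -> k \in tok e -> k \in tok e' -> e = e'.
Proof.
move=> /andP[/forallP/(_ k)/eqP card_k _] De De' ke ke'.
apply: (card_le1_eqP (A := [set e in D | k \in tok e])); rewrite ?inE ?De ?De' //.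
by rewrite card_k; case: (k \in L).
Qed.

Lemma exact_cover_sub L (D : {set E}) e : exact_cover L D -> e \in D -> tok e \subset L.
Proof.
move=> /andP[/forallP card_L _] De; apply/subsetP => k ke; apply: contraT => kL.
have := card_L k; rewrite (negPf kL) cards_eq0 => /eqP/setP/(_ e).
by rewrite !inE De ke.
Qed.

Lemma exact_cover_ex L D k : exact_cover L D -> k \in L ->
  exists2 e, e \in D & k \in tok e.
Proof.
move=> /andP[/forallP/(_ k)/eqP + _] kL; rewrite kL => /eqP/cards1P[e /setP/(_ e)].
by rewrite !inE eqxx => /andP[]; exists e.
Qed.

Lemma exact_coverU1 L (D : {set E}) e : e \notin D ->
  exact_cover L (e |: D) =
  [&& tok e \subset L, tok e != set0 & exact_cover (L :\: tok e) D].
Proof.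
move=> De; rewrite /exact_cover.
have card_k k : #|[set e' in e |: D | k \in tok e']| =
    ((k \in tok e) + #|[set e' in D | k \in tok e']|)%N.
  have [ke|ke] := boolP (k \in tok e); last first.
    apply: eq_card => e'; rewrite !inE; case: eqP => // ->.
    by rewrite (negPf ke) !andbF.
  transitivity #|e |: [set e' in D | k \in tok e']|.
    by apply: eq_card => e'; rewrite !inE; case: eqP => [->|].
  by rewrite cardsU1 !inE (negPf De).
apply/idP/idP => [/andP[/forallP cov /forall_inP ne]|].
  apply/and3P; split.
  - apply/subsetP => k ke; have := cov k; rewrite card_k ke.
    by case: (k \in L).
  - by apply: ne; rewrite setU11.
  - apply/andP; split; last by apply/forall_inP => e' De'; apply: ne; rewrite setU1r.
    apply/forallP => k; have := cov k; rewrite card_k inE.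
    by case: (k \in tok e); case: (k \in L) => //=; rewrite addSn.
move=> /and3P[sub ne0 /andP[/forallP cov /forall_inP ne]]; apply/andP; split.
  apply/forallP => k; have := cov k; rewrite card_k inE => /eqP ->.
  by have := subsetP sub k; case: (k \in tok e) => //= ->.
by apply/forall_inP => e'; rewrite !inE => /predU1P[-> //|]; apply: ne.
Qed.

Lemma exact_coverD_notin L (D : {set E}) e k : k \in tok e -> exact_cover (L :\: tok e) D ->
  e \notin D.
Proof.
move=> ke cov; apply/negP => De.
by have /subsetP/(_ _ ke) := exact_cover_sub cov De; rewrite inE ke.
Qed.

Lemma exact_cover0 D : exact_cover set0 D = (D == set0).
Proof.
apply/idP/eqP => [cov|->].
  apply/setP => e; rewrite inE; apply/negP => De.
  have := exact_cover_sub cov De; rewrite subset0.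
  by move: cov => /andP[_ /forall_inP/(_ e De)/negPf ->].
apply/andP; split; last by apply/forall_inP => e; rewrite inE.
apply/forallP => k; rewrite inE; apply/eqP/eqP; rewrite cards_eq0.
by apply/eqP/setP => e; rewrite !inE.
Qed.

(** Exactly one element e of a cover contains k, and removing it is a bijection onto the exact
    covers of the remaining tokens. *)
Lemma sum_exact_cover (V : nmodType) (G : {set E} -> V) (L : {set X}) k : k \in L ->
  \sum_(D | exact_cover L D) G D =
  \sum_(e | (k \in tok e) && (tok e \subset L))
    \sum_(D | exact_cover (L :\: tok e) D) G (e |: D).
Proof.
move=> kL.
transitivity (\sum_(D | exact_cover L D) \sum_(e | (e \in D) && (k \in tok e)) G D).
  apply: eq_bigr => D cov; have [e De ke] := exact_cover_ex cov kL.
  rewrite (big_pred1 e) // => e'; rewrite /=; apply/andP/eqP => [[De' ke']|-> //].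
  exact: exact_cover_uniq cov De' De ke' ke.
rewrite (exchange_big_dep (fun e => (k \in tok e) && (tok e \subset L))) /=; last first.
  by move=> D e cov /andP[De ->]; apply: exact_cover_sub cov De.
apply: eq_bigr => e /andP[ke sub].
rewrite (reindex_onto (fun D => e |: D) (fun D => D :\ e)) /=; last first.
  by move=> D /and3P[_ De _]; rewrite setD1K.
apply: eq_bigl => D; rewrite setU11 ke /=.
have [De|De] := boolP (e \in D); last first.
  rewrite setU1K // eqxx exact_coverU1 // sub !andbT /=.
  by rewrite (_ : tok e != set0) //; apply/set0Pn; exists k.
rewrite [_ == D](_ : _ = false) ?andbF; last first.
  by apply/eqP => /setP/(_ e); rewrite De !inE eqxx.
by apply/esym/negP => /(exact_coverD_notin ke); rewrite De.
Qed.
End ExactCover.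

Lemma pos_rootP (r : pos_root) : [\/ r = r21, r = r31 | r = r32].
Proof.
case: r => -[[[|[|[|a]]] Ha] [[|[|[|b]]] Hb]] //= ab.
- by constructor 1; apply: val_inj; congr pair; apply: val_inj.
- by constructor 2; apply: val_inj; congr pair; apply: val_inj.
- by constructor 3; apply: val_inj; congr pair; apply: val_inj.
Qed.

(** * Assignments of variables and their sets of nodes *)

Section Nodes.
Context (K : numFieldType) (n l1 l2 : nat).
Context (z : 'I_n -> K) (t1 : 'I_l1 -> K) (t2 : 'I_l2 -> K).

(* The node (s, (o1, o2)) is a factor e_21, e_31 or e_32 at the site s, together *)
(* with the variables t1_i (o1 = Some i) and t2_j (o2 = Some j) assigned to it;  *)
(* the node (s, (None, None)) never belongs to an exact cover.                   *)
Definition node : Type := 'I_n * (option 'I_l1 * option 'I_l2).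
HB.instance Definition _ := Finite.on node.

Definition tok (e : node) : {set 'I_l1 + 'I_l2} :=
  [set k | match k with inl i => e.2.1 == Some i | inr j => e.2.2 == Some j end].

Definition node_root (e : node) : pos_root :=
  match e.2 with
  | (Some _, None) => r21 | (Some _, Some _) => r31 | (None, _) => r32
  end.

Definition color (e : node) : 'I_n * pos_root := (e.1, node_root e).

Definition wt (e : node) : K :=
  match e.2 with
  | (Some i, None) => (t1 i - z e.1)^-1
  | (None, Some j) => (t2 j - z e.1)^-1
  | (Some i, Some j) => ((t1 i - z e.1) * (t2 j - t1 i))^-1
  | (None, None) => 0
  end.

(** These multiplicities are the exponents of the PBW monomial belonging to D. *)
Definition cnt (D : {set node}) (x : 'I_n * pos_root) : nat :=
  #|[set e in D | color e == x]|.

Section FixedCollection.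
Context (I : collection n l1 l2).
Notation assignment := ({ffun S1 I -> 'I_l1} * {ffun S2 I -> 'I_l2})%type.
Implicit Types (beta : assignment) (s : S_ I).

(** [insub] fails exactly when s lies outside S_1 (resp. S_2), so each option is [None] precisely
    when s carries no variable of that kind. *)
Definition bnode beta s : node :=
  (S_site s, (omap beta.1 (insub s), omap beta.2 (insub s))).

Lemma bnode1 beta (s : S1 I) : (bnode beta (val s)).2.1 = Some (beta.1 s).
Proof. by rewrite /bnode /= valK. Qed.

Lemma bnode2 beta (s : S2 I) : (bnode beta (val s)).2.2 = Some (beta.2 s).
Proof. by rewrite /bnode /= valK. Qed.

Lemma bnode1_inv beta s i : (bnode beta s).2.1 = Some i ->
  exists2 s1 : S1 I, val s1 = s & beta.1 s1 = i.
Proof. by rewrite /bnode /=; case: insubP => //= s1 _ <- [<-]; exists s1. Qed.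

Lemma bnode2_inv beta s j : (bnode beta s).2.2 = Some j ->
  exists2 s2 : S2 I, val s2 = s & beta.2 s2 = j.
Proof. by rewrite /bnode /=; case: insubP => //= s2 _ <- [<-]; exists s2. Qed.

Lemma S_rootP s :
  [\/ [/\ S_root s = r21, (val (S_root s)).2 == ix1
        & ((val (S_root s)).1 == ix3) = false],
      [/\ S_root s = r31, (val (S_root s)).2 == ix1
        & (val (S_root s)).1 == ix3]
    | [/\ S_root s = r32, ((val (S_root s)).2 == ix1) = false
        & (val (S_root s)).1 == ix3]].
Proof.
by case: (pos_rootP (S_root s)) => ->; [constructor 1|constructor 2|constructor 3].
Qed.

Lemma color_bnode beta s : color (bnode beta s) = tag s.
Proof.
rewrite /color /bnode /= [RHS]surjective_pairing; congr pair.
rewrite /node_root /=; case: (S_rootP s) => -[sr s1 s2].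
- by rewrite insubT insubF //= -/(S_root s) sr.
- by rewrite !insubT //= -/(S_root s) sr.
- by rewrite insubF // insubT //= -/(S_root s) sr.
Qed.

Lemma bnode_inj beta : injective beta.1 -> injective beta.2 -> injective (bnode beta).
Proof.
move=> inj1 inj2 s s' ss'.
have [[i bs]|[j bs]] : (exists i, (bnode beta s).2.1 = Some i) \/
    (exists j, (bnode beta s).2.2 = Some j).
  rewrite /bnode /=; case: (S_rootP s) => -[_ s1 s2].
  - by left; rewrite insubT /=; eexists.
  - by left; rewrite insubT /=; eexists.
  - by right; rewrite insubT /=; eexists.
- have [u <- bu] := bnode1_inv bs; rewrite ss' in bs.
  by have [u' <- bu'] := bnode1_inv bs; congr (val _); apply: inj1; rewrite bu bu'.
- have [u <- bu] := bnode2_inv bs; rewrite ss' in bs.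
  by have [u' <- bu'] := bnode2_inv bs; congr (val _); apply: inj2; rewrite bu bu'.
Qed.

Lemma in_BP beta : reflect
  [/\ injective beta.1, injective beta.2,
      forall i, exists s : S1 I, beta.1 s = i
      & forall j, exists s : S2 I, beta.2 s = j]
  (in_B beta).
Proof.
apply: (iffP idP) => [|[i1 i2 s1 s2]].
  move=> /andP[/andP[/injectiveP i1 /forallP s1]].
  move=> /andP[/injectiveP i2 /forallP s2].
  split=> // [i|j].
    by have /codomP[s ->] := s1 i; exists s.
  by have /codomP[s ->] := s2 j; exists s.
apply/andP; split; apply/andP; split; try exact/injectiveP.
  by apply/forallP => i; have [s <-] := s1 i; apply: codom_f.
by apply/forallP => j; have [s <-] := s2 j; apply: codom_f.
Qed.

Lemma omega_s_bnode beta s : omega_s z t1 t2 beta s = wt (bnode beta s).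
Proof.
rewrite /omega_s /wt /t1_at /t2_at /bnode /=; case: (S_rootP s) => -[sr s1 s2]; rewrite sr.
- by rewrite eqxx insubT insubF.
- by rewrite !insubT.
- by rewrite insubF // insubT.
Qed.

Lemma bnode_exact beta : in_B beta ->
  exact_cover tok setT (bnode beta @: setT).
Proof.
move=> /in_BP[i1 i2 s1 s2]; apply/andP; split; last first.
  apply/forall_inP => _ /imsetP[s _ ->]; apply/set0Pn.
  rewrite /tok; case: (S_rootP s) => -[_ p1 p2].
  - by exists (inl (beta.1 (Sub s p1))); rewrite inE -bnode1 eqxx.
  - by exists (inl (beta.1 (Sub s p1))); rewrite inE -bnode1 eqxx.
  - by exists (inr (beta.2 (Sub s p2))); rewrite inE -bnode2 eqxx.
apply/forallP => k; rewrite inE; apply/cards1P.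
case: k => [i|j].
  have [s <-] := s1 i; exists (bnode beta (val s)); apply/setP => e; rewrite !inE.
  apply/andP/eqP => [[/imsetP[s' _ ->] /eqP/bnode1_inv[u <- /i1 ->] //]|->].
  by rewrite imset_f // bnode1.
have [s <-] := s2 j; exists (bnode beta (val s)); apply/setP => e; rewrite !inE.
apply/andP/eqP => [[/imsetP[s' _ ->] /eqP/bnode2_inv[u <- /i2 ->] //]|->].
by rewrite imset_f // bnode2.
Qed.

Lemma cnt_bnode beta x : in_B beta -> cnt (bnode beta @: setT) x = I x.
Proof.
move=> /in_BP[i1 i2 _ _]; rewrite /cnt.
have bi := bnode_inj i1 i2.
transitivity #|bnode beta @: [set s | tag s == x]|.
  apply: eq_card => e; rewrite !inE; apply/andP/imsetP.
    by move=> [/imsetP[s _ ->]]; rewrite color_bnode => sx; exists s; rewrite // inE.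
  by move=> [s]; rewrite inE => sx ->; rewrite imset_f // color_bnode.
rewrite card_imset //.
transitivity #|[set Tagged (fun x => 'I_(I x)) q | q : 'I_(I x)]|.
  apply: eq_card => s; rewrite inE; apply/eqP/imsetP => [<-|[q _ ->] //].
  by exists (tagged s); case: s.
rewrite card_imset ?card_ord //.
by move=> q q'; apply: eq_from_Tagged.
Qed.

Section Fibre.
Context (D : {set node}) (D_cover : exact_cover tok setT D).
Context (D_cnt : forall x, cnt D x = I x).

Let fam := {dffun forall x : 'I_n * pos_root, {ffun 'I_(I x) -> node}}.
Let block x : pred {ffun 'I_(I x) -> node} :=
  mem [set f : {ffun 'I_(I x) -> node} in
    ffun_on [set e in D | color e == x] | injectiveb f].

Lemma card_block_family : #|(family block : simpl_pred fam)| = (\prod_x (I x)`!)%N.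
Proof.
rewrite card_family foldrE big_map big_enum /=; apply: eq_bigr => x _.
rewrite /block -[LHS]/#|[set f : {ffun 'I_(I x) -> node} in
    ffun_on [set e in D | color e == x] | injectiveb f]|.
by rewrite card_inj_ffuns_on card_ord -/(cnt D x) D_cnt ffactnn.
Qed.

Lemma cover_node_neq e : e \in D -> e.2 != (None, None).
Proof.
case/andP: D_cover => _ /forall_inP ne /ne /set0Pn[[i|j]];
by rewrite inE; apply: contraTneq => ->.
Qed.

Lemma block_familyP (f : fam) : f \in family block ->
  (forall x q, f x q \in D) /\ (forall x q, color (f x q) = x) /\
  injective (fun s : S_ I => f (tag s) (tagged s)).
Proof.
move=> /familyP ff.
have fx x : (forall q, f x q \in [set e in D | color e == x]) /\ injective (f x).
  have := ff x; rewrite inE => /andP[/ffun_onP ? /injectiveP]; by split.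
have fD x q : f x q \in D by have := (fx x).1 q; rewrite inE => /andP[].
have fc x q : color (f x q) = x.
  by have := (fx x).1 q; rewrite inE => /andP[_ /eqP].
split=> //; split=> // -[x q] [x' q'] /= e.
have xx' : x = x' by rewrite -(fc x q) e fc.
by move: q' e; rewrite -xx' => q' /(fx x).2 ->.
Qed.

(** For each color x, f x is an injection of I x slots into the I x nodes of D of that color, hence
    onto. *)
Lemma block_family_surj (f : fam) e : f \in family block -> e \in D ->
  exists s : S_ I, f (tag s) (tagged s) = e.
Proof.
move=> ff De; have [fD [fc fi]] := block_familyP ff; pose x := color e.
have : e \in f x @: setT.
  suff -> : f x @: setT = [set e in D | color e == x] by rewrite inE De eqxx.
  apply/eqP; rewrite eqEcard; apply/andP; split.
    by apply/subsetP => _ /imsetP[q _ ->]; rewrite inE fD fc eqxx.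
  rewrite -/(cnt D x) D_cnt card_imset ?cardsT ?card_ord // => q q' qq'.
  have := fi (Tagged (fun x => 'I_(I x)) q) (Tagged (fun x => 'I_(I x)) q') qq'.
  exact: eq_from_Tagged.
by case/imsetP => q _ ->; exists (Tagged (fun x => 'I_(I x)) q).
Qed.

Definition bfam (beta : assignment) : fam :=
  [ffun x => [ffun q => bnode beta (Tagged (fun x => 'I_(I x)) q)]].

Lemma bfamE beta s : bfam beta (tag s) (tagged s) = bnode beta s.
Proof. by rewrite /bfam !ffunE; case: s. Qed.

Lemma bfam_inj : injective bfam.
Proof.
move=> b b' bb'.
have nn s : bnode b s = bnode b' s by rewrite -!bfamE bb'.
have e1 : b.1 = b'.1.
  by apply/ffunP => s; have := bnode1 b s; rewrite nn bnode1 => -[].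
have e2 : b.2 = b'.2.
  by apply/ffunP => s; have := bnode2 b s; rewrite nn bnode2 => -[].
by rewrite [b]surjective_pairing e1 e2 -surjective_pairing.
Qed.

(** The color of a node tells which variables it carries, in agreement with the membership of the
    slot s in S_1 and S_2. The variables stored in the node can therefore be read off as the values
    of beta at s. *)
Lemma block_family_node (f : fam) : f \in family block ->
  exists beta, forall s, bnode beta s = f (tag s) (tagged s).
Proof.
move=> ff; have [fD [fc fi]] := block_familyP ff.
have fs (s : S_ I) : [/\ (f (tag s) (tagged s)).1 = S_site s,
    isSome (f (tag s) (tagged s)).2.1 = ((val (S_root s)).2 == ix1) &
    isSome (f (tag s) (tagged s)).2.2 = ((val (S_root s)).1 == ix3)].
  rewrite /S_site /S_root; move: (cover_node_neq (fD _ (tagged s))) (fc _ (tagged s)).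
  by case: (f _ _) => [? [[i|] [j|]]] // _ <-.
have ex1 (s : S1 I) : exists i, (f (tag (val s)) (tagged (val s))).2.1 == Some i.
  have [_ + _] := fs (val s); rewrite (valP s).
  by case: (_.2.1) => // i _; exists i.
have ex2 (s : S2 I) : exists j, (f (tag (val s)) (tagged (val s))).2.2 == Some j.
  have [_ _] := fs (val s); rewrite (valP s).
  by case: (_.2.2) => // j _; exists j.
exists ([ffun s => xchoose (ex1 s)], [ffun s => xchoose (ex2 s)]) => s.
have [f1 f2 f3] := fs s; rewrite /bnode /= -f1.
rewrite [RHS]surjective_pairing [in RHS](surjective_pairing (_.2)).
congr (_, (_, _)).
  case: insubP => /= [u _ us|]; last by rewrite -f2; case: (_.2.1).
  by rewrite ffunE; move: (xchoose _) (xchooseP (ex1 u)) => i;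
    rewrite (us : val u = s) => /eqP ->.
case: insubP => /= [u _ us|]; last by rewrite -f3; case: (_.2.2).
by rewrite ffunE; move: (xchoose _) (xchooseP (ex2 u)) => i;
    rewrite (us : val u = s) => /eqP ->.
Qed.

Lemma bfam_in_family beta : in_B beta -> bnode beta @: setT = D ->
  bfam beta \in family block.
Proof.
move=> bB bD; have [i1 i2 _ _] := in_BP _ bB; apply/familyP => x.
rewrite in_set; apply/andP; split.
  apply/ffun_onP => q; rewrite [bfam _ _]ffunE ffunE in_set color_bnode eqxx andbT.
  by rewrite -bD imset_f.
apply/injectiveP => q q'; rewrite [bfam _ _]ffunE !ffunE => /(bnode_inj i1 i2).
exact: eq_from_Tagged.
Qed.

(** Uniqueness of the node containing a given variable makes the two components of beta injective;
    existence of such a node makes them surjective. *)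
Lemma bfam_surj (f : fam) : f \in family block ->
  exists beta, [/\ in_B beta, bnode beta @: setT = D & f = bfam beta].
Proof.
move=> ff; have [b bf] := block_family_node ff; have [fD [fc fi]] := block_familyP ff.
have bD s : bnode b s \in D by rewrite bf.
have bnD e : e \in D -> exists s, bnode b s = e.
  by move=> De; have [s <-] := block_family_surj ff De; exists s; rewrite bf.
have bi : injective (bnode b) by move=> s s'; rewrite !bf => /fi.
exists b; split; last 2 first.
- apply/setP => e; apply/imsetP/idP => [[s _ ->] //|/bnD[s <-]].
  by exists s.
- by apply/ffunP => x; apply/ffunP => q; rewrite [bfam _ _]ffunE ffunE bf.
apply/in_BP; split.
- move=> s s' ss'; apply: val_inj; apply: bi.
  by apply: (exact_cover_uniq (k := inl (b.1 s)) D_cover); rewrite ?bD // in_set bnode1 // ss'.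
- move=> s s' ss'; apply: val_inj; apply: bi.
  by apply: (exact_cover_uniq (k := inr (b.2 s)) D_cover); rewrite ?bD // in_set bnode2 // ss'.
- move=> i; have [e De] := exact_cover_ex D_cover (in_setT (inl i)).
  have [s <-] := bnD e De; rewrite in_set => /eqP/bnode1_inv[s1 _ <-].
  by exists s1.
- move=> j; have [e De] := exact_cover_ex D_cover (in_setT (inr j)).
  have [s <-] := bnD e De; rewrite in_set => /eqP/bnode2_inv[s2 _ <-].
  by exists s2.
Qed.

(** An assignment with node set D amounts to a numbering, for each color x, of the nodes of D of
    that color by the I x slots. There are I x factorial numberings for each x. *)
Lemma card_fibre :
  #|[set beta : assignment | in_B beta && (bnode beta @: setT == D)]|
  = (\prod_x (I x)`!)%N.
Proof.
rewrite -card_block_family -(card_imset _ bfam_inj); apply: eq_card => f.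
apply/imsetP/idP => [[b]|/bfam_surj[b [bB bD ->]]].
  by rewrite in_set => /andP[bB /eqP bD] ->; apply: bfam_in_family.
by exists b; rewrite // in_set bB bD eqxx.
Qed.
End Fibre.

(* The factorials of omega_I cancel the number of assignments beta with a given *)
(* set of nodes.                                                                *)
Lemma omega_I_cover : omega_I z t1 t2 I =
  \sum_(D | exact_cover tok setT D && [forall x, cnt D x == I x])
    \prod_(e in D) wt e.
Proof.
rewrite /omega_I (partition_big (fun b => bnode b @: setT)
  (fun D => exact_cover tok setT D && [forall x, cnt D x == I x])) /=; last first.
  move=> b bB; rewrite bnode_exact //; apply/forallP => x.
  by rewrite cnt_bnode.
rewrite mulr_sumr; apply: eq_bigr => D /andP[cov /forallP c].
have {}c x : cnt D x = I x by apply/eqP.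
rewrite (eq_bigr (fun _ => \prod_(e in D) wt e)); last first.
  move=> b /andP[bB /eqP <-]; have [i1 i2 _ _] := in_BP _ bB.
  rewrite big_imset /=; last by move=> s s' _ _; apply: bnode_inj.
  by apply: eq_big => [s|s _]; rewrite ?inE // omega_s_bnode.
set W := \prod_(e in D) wt e.
have -> : \sum_(b | in_B b && (bnode b @: setT == D)) W = W *+ (\prod_x (I x)`!).
  transitivity (\sum_(b in [set b : assignment | in_B b && (bnode b @: setT == D)]) W).
    by apply: eq_bigl => b; rewrite inE.
  by rewrite sumr_const card_fibre.
rewrite -(mulr_natl W) mulrA mulVf ?mul1r //.
by rewrite Num.Theory.pnatr_eq0 -lt0n prodn_gt0 // => x; apply: fact_gt0.
Qed.
End FixedCollection.
End Nodes.

(** * Recursion for the weight function *)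

Lemma setD1C (X : finType) (A : {set X}) a b : A :\ a :\ b = A :\ b :\ a.
Proof. by apply/setP => x; rewrite !inE andbCA. Qed.

Lemma big_option (V : nmodType) (J : finType) (P : pred (option J)) (F : option J -> V) :
  P None ->
  \sum_(o | P o) F o = F None + \sum_(j | P (Some j)) F (Some j).
Proof.
move=> PN; rewrite (bigD1 None) //=; congr (_ + _).
rewrite (reindex_omap Some id) /=; last by case=> // /andP[].
by apply: eq_bigl => j; rewrite andbT eqxx andbT.
Qed.

Lemma sum_Some (m : nat) (o : option 'I_m) : (\sum_(i < m) (o == Some i) = isSome o)%N.
Proof.
case: o => [i|]; last by rewrite big1.
by rewrite (bigD1 i) //= eqxx big1 // => k; rewrite (inj_eq (@Some_inj _)) eq_sym => /negPf ->.
Qed.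

Lemma act0 (K : fieldType) (W : sl3_module K) (w : W) : act W 0 w = 0.
Proof. apply: (addIr (act W 0 w)).
by have := act_linear 1 0 0 w; rewrite !scale1r addr0 add0r => <-. Qed.

Lemma iter_actC (K : fieldType) (W : sl3_module K) A B k (w : W) : sl3_bracket A B = 0 ->
  act W A (iter k (act W B) w) = iter k (act W B) (act W A w).
Proof.
move=> AB; elim: k => //= k IHk; rewrite -IHk; apply/eqP.
by rewrite -subr_eq0 -act_bracket AB act0.
Qed.

(** * Actions on tensor factors, brackets and currents *)

Section TensorActions.
Context (K : fieldType) (n : nat) (M : 'I_n -> sl3_module K).
Context (T : tensor_product M).
Implicit Types (A B : sl3 K) (v w : T) (r s : 'I_n).

Lemma factor_act_linear c A B s v :
  factor_act T s (c *: A + B) v = c *: factor_act T s A v + factor_act T s B v.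
Proof.
pose f := (c \*: factor_act T s A \+ factor_act T s B : {linear T -> T}).
change (factor_act T s (c *: A + B) v = f v); apply: tensor_ext => m.
by rewrite /f /= !factor_actE act_linear tensor_multilinear.
Qed.

Lemma factor_act_bracket A B s v :
  factor_act T s (sl3_bracket A B) v =
  factor_act T s A (factor_act T s B v) - factor_act T s B (factor_act T s A v).
Proof.
pose f := ((factor_act T s A \o factor_act T s B)
  \- (factor_act T s B \o factor_act T s A) : {linear T -> T}).
change (factor_act T s (sl3_bracket A B) v = f v); apply: tensor_ext => m.
rewrite /f /= !factor_actE !dfwith_in !dfwith_dfwith act_bracket.
rewrite addrC -scaleN1r tensor_multilinear addrC scaleN1r //.
Qed.

Lemma factor_actC A B r s v : r != s ->
  factor_act T r A (factor_act T s B v) = factor_act T s B (factor_act T r A v).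
Proof.
move=> rs.
change ((factor_act T r A \o factor_act T s B) v = (factor_act T s B \o factor_act T r A) v).
apply: tensor_ext => m; rewrite /= !factor_actE.
by rewrite !dfwith_out // 1?eq_sym // dfwithC // eq_sym.
Qed.
End TensorActions.
Section Brackets.
Context (K : fieldType).
Notation e := (sl3_e K).
Notation br := (@sl3_bracket K).

Ltac bracket := apply: subvs_inj; rewrite /= ?linearN ?linearZ /= ?vsval_h ?vsval_e //;
  rewrite ?(mulmxBl, mulmxBr) !mul_delta_mx_cond /= ?mulr0n ?mulr1n
    ?(subr0, sub0r, subrr, addr0, scale1r, linear0, opprK) //.

Lemma bracket_e31_e21 : br (e ix3 ix1) (e ix2 ix1) = 0. Proof. bracket. Qed.
Lemma bracket_e32_e31 : br (e ix3 ix2) (e ix3 ix1) = 0. Proof. bracket. Qed.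
Lemma bracket_e32_e21 : br (e ix3 ix2) (e ix2 ix1) = e ix3 ix1. Proof. bracket. Qed.
Lemma bracket_e12_e21 : br (e ix1 ix2) (e ix2 ix1) = h1 K. Proof. bracket. Qed.
Lemma bracket_e12_e31 : br (e ix1 ix2) (e ix3 ix1) = - e ix3 ix2. Proof. bracket. Qed.
Lemma bracket_e12_e32 : br (e ix1 ix2) (e ix3 ix2) = 0. Proof. bracket. Qed.
Lemma bracket_e23_e21 : br (e ix2 ix3) (e ix2 ix1) = 0. Proof. bracket. Qed.
Lemma bracket_e23_e31 : br (e ix2 ix3) (e ix3 ix1) = e ix2 ix1. Proof. bracket. Qed.
Lemma bracket_e23_e32 : br (e ix2 ix3) (e ix3 ix2) = h2 K. Proof. bracket. Qed.
Lemma bracket_h1_e21 : br (h1 K) (e ix2 ix1) = - 2%:R *: e ix2 ix1.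
Proof. bracket. by rewrite scaleNr scaler_nat mulr2n opprD. Qed.
Lemma bracket_h2_e21 : br (h2 K) (e ix2 ix1) = e ix2 ix1. Proof. bracket. Qed.
Lemma bracket_h1_e32 : br (h1 K) (e ix3 ix2) = e ix3 ix2. Proof. bracket. Qed.
Lemma bracket_h2_e32 : br (h2 K) (e ix3 ix2) = - 2%:R *: e ix3 ix2.
Proof. bracket. by rewrite scaleNr scaler_nat mulr2n opprD. Qed.
Lemma bracket_h1_e31 : br (h1 K) (e ix3 ix1) = - e ix3 ix1. Proof. bracket. Qed.
Lemma bracket_h2_e31 : br (h2 K) (e ix3 ix1) = - e ix3 ix1. Proof. bracket. Qed.
End Brackets.

Section Current.
Context (K : fieldType) (n : nat) (M : 'I_n -> sl3_module K).
Context (T : tensor_product M) (z : 'I_n -> K).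
Implicit Types (A B : sl3 K) (v w : T) (r s : 'I_n).

Definition current A (u : K) (v : T) : T :=
  \sum_s (u - z s)^-1 *: factor_act T s A v.

Fact current_linear A u : linear (current A u).
Proof.
move=> c v w; rewrite /current scaler_sumr -big_split; apply: eq_bigr => s _ /=.
by rewrite linearP scalerDr !scalerA mulrC.
Qed.
HB.instance Definition _ A u := GRing.isLinear.Build K T T _ (current A u) (current_linear A u).

Lemma factor_act0 s v : factor_act T s 0 v = 0.
Proof. apply: (addIr (factor_act T s 0 v)).
by have := factor_act_linear 1 0 0 s v; rewrite !scale1r addr0 add0r => <-. Qed.

Lemma factor_actZ c A s v : factor_act T s (c *: A) v = c *: factor_act T s A v.
Proof. by have := factor_act_linear c A 0 s v; rewrite !addr0 factor_act0 addr0. Qed.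

Lemma factor_actN A s v : factor_act T s (- A) v = - factor_act T s A v.
Proof. by rewrite -(scaleN1r A) factor_actZ scaleN1r. Qed.

Lemma current_commute A B u u' v : sl3_bracket A B = 0 ->
  current A u (current B u' v) = current B u' (current A u v).
Proof.
move=> AB; rewrite /current.
under eq_bigr do rewrite linear_sum scaler_sumr.
under [RHS]eq_bigr do rewrite linear_sum scaler_sumr.
rewrite [RHS]exchange_big; apply: eq_bigr => r _; apply: eq_bigr => s _ /=.
rewrite !linearZ /= !scalerA mulrC; congr (_ *: _).
have [<-|rs] := eqVneq r s; last by rewrite factor_actC.
by apply/eqP; rewrite -subr_eq0 -factor_act_bracket AB factor_act0.
Qed.

(** Actions at different sites commute, so only the diagonal of the double sum remains. There 1/((u
    - z)(u' - z)) = (1/(u' - z) - 1/(u - z))/(u - u'). *)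
Lemma current_bracket A B u u' v : u != u' -> (forall s, u != z s) -> (forall s, u' != z s) ->
  current A u (current B u' v) - current B u' (current A u v) =
  (u - u')^-1 *: (current (sl3_bracket A B) u' v - current (sl3_bracket A B) u v).
Proof.
move=> uu' uz u'z; rewrite /current.
under eq_bigr do rewrite linear_sum scaler_sumr.
under [X in _ - X]eq_bigr do rewrite linear_sum scaler_sumr.
rewrite [X in _ - X]exchange_big -sumrB -sumrB scaler_sumr; apply: eq_bigr => r _ /=.
rewrite -sumrB (bigD1 r) //= big1 ?addr0 => [|s sr]; last first.
  by rewrite !linearZ /= !scalerA (factor_actC _ _ _ sr) scalerN subrr.
rewrite !linearZ /= !scalerA -scalerDr -factor_act_bracket scalerN -scalerBl scalerA.
congr (_ *: _).
have {}uz s : u - z s != 0 by rewrite subr_eq0.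
have {}u'z s : u' - z s != 0 by rewrite subr_eq0.
by field; rewrite uz u'z subr_eq0 uu'.
Qed.
End Current.

Section WeightFunctionRecursion.
Context (K : numFieldType) (n l1 l2 : nat).
Context (z : 'I_n -> K) (t1 : 'I_l1 -> K) (t2 : 'I_l2 -> K).
Context (Lambda : 'I_n -> weight K) (M : forall j, verma_module (Lambda j)).
Context (T : tensor_product (fun j => M j)).
Notation node := (node n l1 l2).
Notation wt := (wt z t1 t2).
Notation e21 := (sl3_e K ix2 ix1).
Notation e31 := (sl3_e K ix3 ix1).
Notation e32 := (sl3_e K ix3 ix2).
Implicit Types (D : {set node}) (L : {set 'I_l1 + 'I_l2}).

Definition pbw (c : 'I_n * pos_root -> nat) (j : 'I_n) : M j :=
  iter (c (j, r21)) (act (M j) e21)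
    (iter (c (j, r31)) (act (M j) e31)
      (iter (c (j, r32)) (act (M j) e32) (verma_vec (M j)))).

Definition incr (x : 'I_n * pos_root) (c : 'I_n * pos_root -> nat) y :=
  ((x == y) + c y)%N.

(* The weight function of the variables t1_i and t2_j with inl i and inr j in L. *)
Definition Omega L : T :=
  \sum_(D | exact_cover (@tok n l1 l2) L D)
    (\prod_(e in D) wt e) *: tensor T (pbw (cnt D)).

Lemma cntU1 D e : e \notin D -> cnt (e |: D) = incr (color e) (cnt D).
Proof.
move=> De; apply/funext => x; rewrite /cnt /incr.
have [ex|ex] := boolP (color e == x); last first.
  apply: eq_card => e'; rewrite !inE; case: eqP => // ->.
  by rewrite (negPf ex) !andbF.
transitivity #|e |: [set e' in D | color e' == x]|.
  by apply: eq_card => e'; rewrite !inE; case: eqP => [->|].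
by rewrite cardsU1 !inE (negPf De).
Qed.

Definition root_vec (r : pos_root) : sl3 K := sl3_e K (val r).1 (val r).2.

(** The vector e_31 commutes past the e_21 standing on the left, and e_32 past e_31. But e_32 does
    not commute with e_21, whence the condition in that case. *)
Lemma act_pbw (c : 'I_n * pos_root -> nat) j r : r != r32 \/ c (j, r21) = 0%N ->
  act (M j) (root_vec r) (pbw c j) = pbw (incr (j, r) c) j.
Proof.
have br1 := bracket_e31_e21 K; have br2 := bracket_e32_e31 K.
rewrite /pbw /incr !xpair_eqE !eqxx /=.
case: (pos_rootP r) => -> /=; rewrite /root_vec /=.
- by [].
- by move=> _; rewrite iter_actC.
- by case=> // ->; rewrite /= iter_actC.
Qed.

Lemma factor_act_pbw c j r : r != r32 \/ c (j, r21) = 0%N ->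
  factor_act T j (root_vec r) (tensor T (pbw c)) = tensor T (pbw (incr (j, r) c)).
Proof.
move=> hc; rewrite factor_actE; congr (tensor T _).
apply: functional_extensionality_dep => i.
have [<-|ji] := eqVneq j i; first by rewrite dfwith_in act_pbw.
rewrite dfwith_out // /pbw /incr !xpair_eqE.
by rewrite (negPf ji).
Qed.

(** If L contains no variable t1_i, no node of D contributes an e_21. This is the situation in which
    [act_pbw] allows an e_32 to be pulled out. *)
Lemma Omega_node L e k : k \in tok e ->
  (node_root e != r32 \/ forall i, inl i \notin L) ->
  \sum_(D | exact_cover (@tok n l1 l2) (L :\: tok e) D)
    (\prod_(e' in e |: D) wt e') *: tensor T (pbw (cnt (e |: D))) =
  wt e *: factor_act T e.1 (root_vec (node_root e)) (Omega (L :\: tok e)).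
Proof.
move=> ke hL; rewrite /Omega linear_sum scaler_sumr; apply: eq_bigr => D cov.
have De := exact_coverD_notin ke cov.
rewrite big_setU1 //= linearZ /= scalerA; congr (_ *: _).
rewrite cntU1 // factor_act_pbw //.
case: hL => [|hL]; [by left|right].
apply/eqP; rewrite cards_eq0; apply/eqP/setP => e'; rewrite !inE.
apply/negP => /andP[De' /eqP[_ re']].
have /subsetP sub := exact_cover_sub cov De'.
case: e' re' De' sub => [s [[i|] [j|]]] //= _ _ sub.
by have := sub (inl i); rewrite !inE /= eqxx (negPf (hL i)) andbF => /(_ isT).
Qed.

(** The node containing t1_i either holds it alone, giving e_21, or together with some t2_j, giving
    e_31 with the additional factor 1/(t2_j - t1_i). Summation over its site produces a current at
    t1_i. *)
Lemma Omega_t1 L i : inl i \in L ->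
  Omega L = current z e21 (t1 i) (Omega (L :\ inl i))
  + \sum_(j | inr j \in L) (t2 j - t1 i)^-1 *:
      current z e31 (t1 i) (Omega (L :\ inl i :\ inr j)).
Proof.
move=> iL; rewrite {1}/Omega (sum_exact_cover _ _ iL).
pose H (e : node) : T := wt e *: factor_act T e.1 (root_vec (node_root e)) (Omega (L :\: tok e)).
rewrite (eq_bigr H); last first.
  move=> [s [o1 o2]] /andP[ie _]; apply: (Omega_node ie); left.
  by move: ie; rewrite inE /= => /eqP ->; case: o2.
have tokS s j : tok ((s, (Some i, Some j)) : node) = [set inl i; inr j].
  by apply/setP => -[a|b]; rewrite !inE; apply/eqP/orP => [[->]|[]/eqP// [->]//];
    [left|right].
have tokN s : tok ((s, (Some i, None)) : node) = [set inl i].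
  by apply/setP => -[a|b]; rewrite !inE /=; apply/eqP/eqP => // -[->].
transitivity (\sum_s \sum_(o : option 'I_l2 | (if o is Some j then inr j \in L else true))
    H (s, (Some i, o))).
  rewrite (pair_big_dep xpredT (fun _ o => if o is Some j then inr j \in L else true)) /=.
  rewrite (reindex_omap (fun p => (p.1, (Some i, p.2)))
     (fun e : node => if e.2.1 is Some _ then Some (e.1, e.2.2) else None)) /=; last first.
    by case=> s [o1 o2] /andP[]; rewrite inE /= => /eqP ->.
  apply: eq_bigl => -[s o] /=; rewrite eqxx andbT.
  case: o => [j|]; rewrite ?tokS ?tokN !inE !eqxx /=.
    by rewrite subUset !sub1set iL.
  by rewrite sub1set iL.
under eq_bigr do rewrite big_option //.
rewrite big_split /= exchange_big /=; congr (_ + _).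
  by apply: eq_bigr => s _; rewrite /H tokN.
apply: eq_bigr => j jL; rewrite scaler_sumr; apply: eq_bigr => s _.
by rewrite /H tokS /wt /= invfM scalerA mulrC setDDl.
Qed.

Lemma Omega_t2_base L j : inr j \in L -> (forall i, inl i \notin L) ->
  Omega L = current z e32 (t2 j) (Omega (L :\ inr j)).
Proof.
move=> jL nL; rewrite {1}/Omega (sum_exact_cover _ _ jL).
pose H (e : node) : T := wt e *: factor_act T e.1 (root_vec (node_root e)) (Omega (L :\: tok e)).
rewrite (eq_bigr H); last by move=> e /andP[je _]; apply: (Omega_node je); right.
have tokN s : tok ((s, (None, Some j)) : node) = [set inr j].
  by apply/setP => -[a|b]; rewrite !inE /=; apply/eqP/eqP => // -[->].
rewrite (reindex_omap (fun s => (s, (None, Some j))) (fun e : node => Some e.1)) /=; last first.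
  case=> s [[i|] o2] /andP[]; rewrite inE /= => /eqP -> // sub.
  by have := subsetP sub (inl i); rewrite inE eqxx (negPf (nL i)) => /(_ isT).
rewrite /current; apply: eq_big => [s|s _]; last by rewrite /H tokN.
by rewrite tokN inE !eqxx sub1set jL.
Qed.

Lemma Omega0 : Omega set0 = tensor T (fun j => verma_vec (M j)).
Proof.
rewrite /Omega (big_pred1 set0) => [|D]; last by rewrite exact_cover0.
rewrite big_set0 scale1r; congr (tensor T _).
apply: functional_extensionality_dep => j; rewrite /pbw.
have c0 x : cnt (set0 : {set node}) x = 0%N.
  by apply/eqP; rewrite cards_eq0; apply/eqP/setP => e; rewrite !inE.
by rewrite !c0.
Qed.

(* The e_32 stand on the right of the PBW monomials, so this is not read off   *)
(* the covers but deduced from Omega_t1 by moving e_32 to the left.             *)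
Lemma Omega_t2 L j : (forall i, t1 i != t2 j) -> (forall s i, z s != t1 i) ->
  (forall s j, z s != t2 j) -> inr j \in L ->
  Omega L = current z e32 (t2 j) (Omega (L :\ inr j))
  + \sum_(i | inl i \in L) (t2 j - t1 i)^-1 *:
      current z e31 (t2 j) (Omega (L :\ inl i :\ inr j)).
Proof.
move=> t12 zt1 zt2.
(* Induction on the number of variables t1_i in L; without them [Omega_t2_base] applies. Otherwise
   both sides are expanded at one such variable i0 by [Omega_t1], and the induction hypothesis is
   used at j on the left. *)
have [m] := ubnP #|[set i | inl i \in L]|; elim: m L => // m IHm L Lm jL.
have [i0 /= i0L|noi] := pickP (fun i => inl i \in L); last first.
  by rewrite big_pred0 // addr0 -Omega_t2_base // => i; rewrite noi.
have Li0m : (#|[set i | inl i \in L :\ inl i0]| < m)%N.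
  rewrite -ltnS; apply: leq_trans Lm; rewrite ltnS; apply: proper_card; apply/properP; split.
    by apply/subsetP => i; rewrite !inE => /andP[].
  by exists i0; rewrite !inE ?eqxx.
set a := t1 i0; set b := t2 j.
have jLi0 : inr j \in L :\ inl i0 by rewrite !inE jL.
rewrite (Omega_t1 i0L) (IHm _ Li0m jLi0).
rewrite [X in _ + X](bigD1 j) //= [X in _ + (_ + X)](eq_bigr (fun j' =>
   (t2 j' - a)^-1 *: (current z e31 a (current z e32 b (Omega (L :\ inl i0 :\ inr j' :\ inr j)))
   + \sum_(i | inl i \in L :\ inl i0) (b - t1 i)^-1 *:
       current z e31 a (current z e31 b (Omega (L :\ inl i0 :\ inr j' :\ inl i :\ inr j)))))); last first.
  move=> j' /andP[j'L j'j]; congr (_ *: _).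
  rewrite (IHm (L :\ inl i0 :\ inr j')); last 2 first.
  - by apply: leq_ltn_trans Li0m; apply: subset_leq_card; apply/subsetP => i; rewrite !inE.
  - by rewrite !inE jL (inj_eq (@inr_inj _ _)) eq_sym j'j.
  rewrite linearD [X in _ + X = _]linear_sum; congr (_ + _).
  apply: eq_big => [i|i _]; first by rewrite /= !inE.
  by rewrite linearZ.
rewrite [in RHS](Omega_t1 (i := i0)); last by rewrite !inE i0L.
rewrite [X in _ = _ + X](bigD1 i0) //=.
rewrite [X in _ = _ + (_ + X)](eq_bigr (fun i =>
   (b - t1 i)^-1 *: (current z e31 b (current z e21 a (Omega (L :\ inl i0 :\ inl i :\ inr j)))
   + \sum_(j' | inr j' \in L :\ inr j) (t2 j' - a)^-1 *:
       current z e31 b (current z e31 a (Omega (L :\ inl i0 :\ inr j' :\ inl i :\ inr j)))))); last first.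
  move=> i /andP[iL ii0]; congr (_ *: _).
  rewrite (Omega_t1 (i := i0)); last first.
    by rewrite !inE i0L andbT /=; apply: contraNneq ii0 => -[->].
  rewrite linearD [X in _ + X = _]linear_sum; congr (_ + _).
    by rewrite (setD1C _ (inr j)) (setD1C L).
  apply: eq_big => [j'|j' _]; first by rewrite /= !inE.
  rewrite linearZ /=; congr (_ *: current _ _ _ (current _ _ _ (Omega _))).
  by apply/setP => k; rewrite !inE; do !bool_congr.
(* Exchanging E_21(a) and E_32(b) creates two E_31 terms. The one at b is the summand i = i0 of the
   right-hand side; the one at a cancels the summand j' = j from [Omega_t1] on the left. *)
have swap (v : T) : current z e21 a (current z e32 b v) = current z e32 b (current z e21 a v)
    + (b - a)^-1 *: current z e31 b v - (b - a)^-1 *: current z e31 a v.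
  have e := @current_bracket K n (fun s => verma_carrier (M s)) T z e32 e21 b a v.
  rewrite -addrA -scalerBr -(opprB (current z e31 a v)) scalerN -(bracket_e32_e21 K) -e.
  - by rewrite opprB addrC subrK.
  - by rewrite eq_sym t12.
  - by move=> s; rewrite eq_sym zt2.
  - by move=> s; rewrite eq_sym zt1.
have commX (v : T) : current z e21 a (current z e31 b v) = current z e31 b (current z e21 a v).
  by rewrite (current_commute _ _ _ _ (bracket_e31_e21 K)).
have commY (v : T) : current z e32 b (current z e31 a v) = current z e31 a (current z e32 b v).
  by rewrite (current_commute _ _ _ _ (bracket_e32_e31 K)).
have commW (v : T) : current z e31 a (current z e31 b v) = current z e31 b (current z e31 a v).
  by apply: current_commute; apply: subvs_inj; rewrite /= subrr.
have shuffle (p q r s1 s2 s3 : T) :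
    p + q - r + s1 + (r + (s2 + s3)) = p + s2 + (q + (s1 + s3)).
  by rewrite [p + q - r + s1]addrAC addrA subrK -[p + q + s1]addrA addrACA -[q + s1 + s3]addrA.
rewrite !linearD /= swap (setD1C L (inr j)).
under [X in _ + (_ + X) = _]eq_bigr do rewrite scalerDr [X in _ + X]scaler_sumr.
under [X in _ = _ + (_ + X)]eq_bigr do rewrite scalerDr [X in _ + X]scaler_sumr.
rewrite [X in _ + (_ + X) = _]big_split [X in _ = _ + (_ + X)]big_split /=.
rewrite shuffle; congr (_ + _ + (_ + (_ + _))).
- rewrite [RHS]linear_sum; apply: eq_big => [j'|j' _].
    by rewrite /= !inE (inj_eq (@inr_inj _ _)) andbC.
  by rewrite linearZ /= commY (setD1C _ (inr j)).
- rewrite [LHS]linear_sum; apply: eq_big => [i|i _].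
    by rewrite /= !inE (inj_eq (@inl_inj _ _)) andbC.
  by rewrite linearZ /= commX.
rewrite [RHS](exchange_big_dep (fun j' => (inr j' \in L) && (j' != j))) /=; last first.
  by move=> i j' _; rewrite !inE (inj_eq (@inr_inj _ _)) andbC.
apply: eq_bigr => j' /andP[j'L j'j].
apply: eq_big => [i|i _].
  by rewrite !inE !(inj_eq (@inl_inj _ _)) !(inj_eq (@inr_inj _ _)) j'L j'j !andbT andbC.
by rewrite !scalerA mulrC commW.
Qed.

Lemma cnt_sum D x : cnt D x = (\sum_(e in D) (color e == x))%N.
Proof.
rewrite /cnt -sum1_card big_mkcond [RHS]big_mkcond; apply: eq_bigr => e _ /=.
by rewrite inE; case: (e \in D); case: (color e == x).
Qed.

Lemma cover_sum_tok D k : exact_cover (@tok n l1 l2) setT D ->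
  (\sum_(e in D) (k \in tok e) = 1)%N.
Proof.
move=> /andP[/forallP/(_ k) + _]; rewrite inE => /eqP E.
rewrite -[RHS]/(nat_of_bool true) -E -sum1_card big_mkcond [RHS]big_mkcond; apply: eq_bigr => e _ /=.
by rewrite !inE; case: (e \in D).
Qed.

Lemma cover_sum1 D : exact_cover (@tok n l1 l2) setT D -> (\sum_(e in D) isSome e.2.1 = l1)%N.
Proof.
move=> cov; under eq_bigr do rewrite -sum_Some.
rewrite exchange_big /= -[RHS]card_ord -sum1_card; apply: eq_bigr => i _.
by rewrite -(cover_sum_tok (inl i) cov); apply: eq_bigr => e _; rewrite inE.
Qed.

Lemma cover_sum2 D : exact_cover (@tok n l1 l2) setT D -> (\sum_(e in D) isSome e.2.2 = l2)%N.
Proof.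
move=> cov; under eq_bigr do rewrite -sum_Some.
rewrite exchange_big /= -[RHS]card_ord -sum1_card; apply: eq_bigr => j _.
by rewrite -(cover_sum_tok (inr j) cov); apply: eq_bigr => e _; rewrite inE.
Qed.

Lemma cover_proper D e : exact_cover (@tok n l1 l2) setT D -> e \in D ->
  isSome e.2.1 || isSome e.2.2.
Proof. by move=> cov /(cover_node_neq cov); case: e => s [[?|] [?|]]. Qed.

(** Every node of a cover holds at least one of the l1 + l2 variables, and no variable is held
    twice. So the multiplicities fit into the finite type [collection]. *)
Lemma cnt_bound D x : exact_cover (@tok n l1 l2) setT D -> (cnt D x < (l1 + l2).+1)%N.
Proof.
move=> cov; rewrite ltnS cnt_sum -[X in (_ <= X + _)%N](cover_sum1 cov).
rewrite -[X in (_ <= _ + X)%N](cover_sum2 cov) -big_split.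
apply: leq_sum => e De; have := cover_proper cov De.
by case: (isSome e.2.1) => /=; case: (isSome e.2.2) => //= _; case: (_ == _).
Qed.

Lemma cnt_in_P D (I : collection n l1 l2) : exact_cover (@tok n l1 l2) setT D ->
  (forall x, I x = cnt D x :> nat) -> in_P I.
Proof.
move=> cov Ic.
have sumE (r r' : pos_root) : (\sum_(j < n) (I (j, r) + I (j, r')) =
    \sum_(e in D) ((node_root e == r) + (node_root e == r')))%N.
  transitivity (\sum_(j < n) \sum_(e in D) ((color e == (j, r)) + (color e == (j, r'))))%N.
    by apply: eq_bigr => j _; rewrite !Ic !cnt_sum -big_split.
  rewrite exchange_big; apply: eq_bigr => e _ /=.
  rewrite (bigD1 e.1) //= big1 ?addn0 => [|j je].
    by rewrite /color !xpair_eqE !eqxx.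
  by rewrite /color !xpair_eqE eq_sym (negPf je).
rewrite /in_P !sumE; apply/andP; split; apply/eqP;
  [rewrite -[RHS](cover_sum1 cov)|rewrite -[RHS](cover_sum2 cov)]; apply: eq_bigr => e De;
  have := cover_proper cov De; rewrite /node_root;
  by case: e {De} => s [[i|] [j|]].
Qed.

(** The covers are grouped by their multiplicities, which form a collection in P(l, n), and
    [omega_I_cover] evaluates each group. *)
Lemma weight_functionE : weight_function z t1 t2 T = Omega setT.
Proof.
rewrite /weight_function /Omega.
rewrite [RHS](partition_big (fun D => [ffun x => inord (cnt D x)] : collection n l1 l2)
  (@in_P n l1 l2)) /=; last first.
  by move=> D cov; apply: (cnt_in_P cov) => x; rewrite ffunE inordK ?cnt_bound.
apply: eq_bigr => I _; rewrite omega_I_cover scaler_suml.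
apply: eq_big => [D|D /andP[_ /forallP DI]]; last first.
  by congr (_ *: tensor T _); apply: functional_extensionality_dep => j;
    rewrite /pbw !(eqP (DI _)).
have [cov|//] := boolP (exact_cover _ _ _).
apply/forallP/eqP => [DI|<- x]; last by rewrite ffunE inordK ?cnt_bound.
by apply/ffunP => x; apply: val_inj; rewrite ffunE /= inordK ?cnt_bound // (eqP (DI x)).
Qed.
End WeightFunctionRecursion.

(** * Gaudin Hamiltonians under a Whittaker functional *)

Section Casimir.
Context (K : fieldType) (K3 : (3%:R : K) != 0).
Context (x : 8.-tuple (sl3 K)) (x_orthonormal : orthonormal_basis x).
Notation e := (sl3_e K).

Lemma orthonormal_expand (A : sl3 K) : A = \sum_k sl3_form A (tnth x k) *: tnth x k.
Proof.
have [bx ox] := x_orthonormal.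
rewrite [LHS](coord_basis bx (memvf A)); apply: eq_bigr => k _.
rewrite (tnth_nth 0); congr (_ *: _).
rewrite {2}(coord_basis bx (memvf A)).
have form_sum (r : seq 'I_8) (c : 'I_8 -> K) B :
    sl3_form (\sum_(i <- r) c i *: x`_i) B = \sum_(i <- r) c i * sl3_form x`_i B.
  elim: r => [|i r IHr]; last by rewrite !big_cons sl3_formDl IHr.
  by rewrite !big_nil /sl3_form linear0 mul0mx mxtrace0.
rewrite form_sum (bigD1 k) //= big1 ?addr0 => [|i ik].
  by rewrite -!tnth_nth ox eqxx mulr1.
by rewrite -!tnth_nth ox (negPf ik) mulr0.
Qed.

(* The weights and pairs of a decomposition of the Casimir element. *)
Definition dual_terms : seq (K * (sl3 K * sl3 K)) :=
  [:: (1, (e ix1 ix2, e ix2 ix1)); (1, (e ix2 ix1, e ix1 ix2));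
      (1, (e ix1 ix3, e ix3 ix1)); (1, (e ix3 ix1, e ix1 ix3));
      (1, (e ix2 ix3, e ix3 ix2)); (1, (e ix3 ix2, e ix2 ix3));
      (2%:R / 3%:R, (h1 K, h1 K)); (3%:R^-1, (h1 K, h2 K));
      (3%:R^-1, (h2 K, h1 K)); (2%:R / 3%:R, (h2 K, h2 K))].

Lemma sl3_form_e (A : sl3 K) a b : a != b -> sl3_form A (e a b) = vsval A b a.
Proof.
move=> ab; rewrite /sl3_form vsval_e // /mxtrace (bigD1 b) //= big1 => [|i ib].
  rewrite addr0 mxE (bigD1 a) //= big1 => [|i ia]; first by rewrite mxE !eqxx mulr1 addr0.
  by rewrite mxE (negPf ia) mulr0.
by rewrite mxE big1 // => k _; rewrite mxE (negPf ib) andbF mulr0.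
Qed.

Lemma sl3_form_hr (A : sl3 K) a b : sl3_form A (sl3_h K a b) = vsval A a a - vsval A b b.
Proof.
have E c : \tr (vsval A *m delta_mx c c) = vsval A c c.
  rewrite /mxtrace (bigD1 c) //= big1 => [|i ib].
    rewrite addr0 mxE (bigD1 c) //= big1 => [|i ia]; first by rewrite mxE !eqxx mulr1 addr0.
    by rewrite mxE (negPf ia) mulr0.
  by rewrite mxE big1 // => k _; rewrite mxE (negPf ib) andbF mulr0.
by rewrite /sl3_form vsval_h mulmxBr linearB /= !E.
Qed.

(** Under the trace form e_ab is dual to e_ba, and the coefficients of the pairs (h_i, h_j) form the
    inverse Cartan matrix. *)
Lemma dual_expand (A : sl3 K) :
  A = \sum_(p <- dual_terms) (p.1 * sl3_form A p.2.2) *: p.2.1.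
Proof.
have trA : vsval A ix1 ix1 + vsval A ix2 ix2 + vsval A ix3 ix3 = 0.
  have := subvsP A; rewrite memv_sl3 /mxtrace !big_ord_recl big_ord0 addr0 addrA => /eqP <-.
  by congr (vsval A _ _ + vsval A _ _ + vsval A _ _); apply: val_inj.
have A33 : vsval A ix3 ix3 = - (vsval A ix1 ix1 + vsval A ix2 ix2).
  by apply/eqP; rewrite eq_sym eqr_oppLR -addr_eq0 trA.
rewrite !big_cons big_nil /= !sl3_form_e // !sl3_form_hr A33.
apply: subvs_inj; rewrite !linearD !linearZ /= !vsval_e // !vsval_h.
apply/matrixP => i j.
(* Expressing the entry through the named indices gives both sides the same atoms after the case
   split on i and j. *)
have -> : vsval A i j = \sum_(a : 'I_3) \sum_(b : 'I_3) ((a == i) && (b == j))%:R * vsval A a b.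
  rewrite (bigD1 i) //= [X in _ + X]big1 ?addr0; last first.
    by move=> a ai; apply: big1 => b _; rewrite (negPf ai) mul0r.
  rewrite (bigD1 j) //= [X in _ + X]big1 ?addr0; last first.
    by move=> b bj; rewrite (negPf bj) andbF mul0r.
  by rewrite !eqxx mul1r.
rewrite !big_ord_recl !big_ord0.
have o1 : ord0 = ix1 by apply: val_inj.
have o2 : lift ord0 ord0 = ix2 by apply: val_inj.
have o3 : lift ord0 (lift ord0 ord0) = ix3 by apply: val_inj.
rewrite o3 o2 o1 A33 !mxE.
case: i j => [[|[|[|i]]] Hi] [[|[|[|j]]] Hj] //; rewrite -!val_eqE /=.
all: rewrite /=; field; done.
Qed.

(** The Casimir element does not depend on the pair of dual bases: expand the first argument by
    [dual_expand], then resum the second over the orthonormal basis. *)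
Lemma casimir_bilinear (V : lmodType K) (b : sl3 K -> sl3 K -> V) :
  (forall c A A' B, b (c *: A + A') B = c *: b A B + b A' B) ->
  (forall c A B B', b A (c *: B + B') = c *: b A B + b A B') ->
  \sum_k b (tnth x k) (tnth x k) = \sum_(p <- dual_terms) p.1 *: b p.2.1 p.2.2.
Proof.
move=> bl br.
have bl0 B : b 0 B = 0.
  by apply: (addIr (b 0 B)); have := bl 1 0 0 B; rewrite !scale1r addr0 add0r => <-.
have br0 A : b A 0 = 0.
  by apply: (addIr (b A 0)); have := br 1 A 0 0; rewrite !scale1r addr0 add0r => <-.
have bls (I : Type) (r : seq I) (c : I -> K) (F : I -> sl3 K) B :
    b (\sum_(i <- r) c i *: F i) B = \sum_(i <- r) c i *: b (F i) B.
  by elim: r => [|i r IHr]; rewrite ?big_nil ?bl0 // !big_cons bl IHr.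
have brs (I : Type) (r : seq I) (c : I -> K) (F : I -> sl3 K) A :
    b A (\sum_(i <- r) c i *: F i) = \sum_(i <- r) c i *: b A (F i).
  by elim: r => [|i r IHr]; rewrite ?big_nil ?br0 // !big_cons br IHr.
transitivity (\sum_k \sum_(p <- dual_terms)
    (p.1 * sl3_form (tnth x k) p.2.2) *: b p.2.1 (tnth x k)).
  by apply: eq_bigr => k _; rewrite -bls -dual_expand.
rewrite exchange_big; apply: eq_bigr => p _ /=.
rewrite [in RHS](orthonormal_expand p.2.2) brs scaler_sumr; apply: eq_bigr => k _.
by rewrite scalerA sl3_formC.
Qed.
End Casimir.

Section WhittakerTensor.
Context (K : fieldType) (n : nat) (Lambda : 'I_n -> weight K).
Context (M : forall j, verma_module (Lambda j)).
Context (T : tensor_product (fun j => M j)) (x y : 'I_n -> K).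
Notation e21 := (sl3_e K ix2 ix1).
Notation e31 := (sl3_e K ix3 ix1).
Notation e32 := (sl3_e K ix3 ix2).

(** The product of the functionals of the single sites is multilinear, so it factors through the
    tensor product. *)
Lemma tensor_whittaker : exists phi : {linear T -> K^o},
  [/\ phi (tensor T (fun j => verma_vec (M j))) = 1,
   forall s v, phi (factor_act T s e21 v) = x s * phi v,
   forall s v, phi (factor_act T s e32 v) = y s * phi v
   & forall s v, phi (factor_act T s e31 v) = 0].
Proof.
pose d s := projT1 (cid (whittaker_functional (M s) (x s) (y s))).
have dP s := projT2 (cid (whittaker_functional (M s) (x s) (y s))).
pose f (m : forall j, M j) : K^o := \prod_s d s (m s).
have f_dfwith m j (u : M j) : f (dfwith m u) = d j u * \prod_(i | i != j) d i (m i).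
  rewrite /f (bigD1 j) //= dfwith_in; congr (_ * _).
  by apply: eq_bigr => i ij; rewrite dfwith_out // eq_sym.
have fM : multilinear (M := fun j => M j : lmodType K) f.
  by move=> m j c u v; rewrite !f_dfwith linearP mulrDl /= -mulrA.
pose phi := tensor_lift T fM : {linear T -> K^o}.
have phi_tensor m : phi (tensor T m) = f m by exact: tensor_liftE.
have phi_act s A c : (forall v, d s (act (M s) A v) = c * d s v) ->
    forall v, phi (factor_act T s A v) = c * phi v.
  move=> dA v.
  change ((phi \o factor_act T s A) v = (c \*: phi) v).
  apply: tensor_ext => m; rewrite /= factor_actE !phi_tensor f_dfwith dA.
  by rewrite -mulrA /f [in RHS](bigD1 s).
exists phi; split.
- rewrite phi_tensor; apply: big1 => s _; have [d1 _ _ _] := dP s; exact: d1.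
- by move=> s; apply: phi_act; have [_ d21 _ _] := dP s; exact: d21.
- by move=> s; apply: phi_act; have [_ _ d32 _] := dP s; exact: d32.
- move=> s v; rewrite (phi_act s e31 0) ?mul0r // => w; rewrite mul0r.
  by have [_ _ _ d31] := dP s; apply: d31.
Qed.

Lemma factor_act_cartan s (h : cartan K) :
  factor_act T s (vsval h) (tensor T (fun j => verma_vec (M j))) =
  Lambda s h *: tensor T (fun j => verma_vec (M j)).
Proof.
rewrite factor_actE; have [_ ->] := verma_highest_weight (M s).
pose m := fun j : 'I_n => verma_vec (M j).
have t0 : tensor T (dfwith m (0 : M s)) = 0.
  apply: (addIr (tensor T (dfwith m (0 : M s)))).
  have := tensor_multilinear T m 1 (0 : M s) 0.
  by rewrite !scale1r addr0 add0r => <-.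
have := tensor_multilinear T m (Lambda s h) (m s) 0; rewrite addr0 t0 addr0 => ->.
congr (_ *: tensor T _).
apply: functional_extensionality_dep => i.
by case: (eqVneq s i) => [<-|si]; rewrite ?dfwith_in ?dfwith_out.
Qed.
End WhittakerTensor.

Section WhittakerGaudin.
Context (K : numFieldType) (n : nat) (M : 'I_n -> sl3_module K).
Context (T : tensor_product M) (x y : 'I_n -> K) (phi : {linear T -> K^o}).
Notation e := (sl3_e K).
Notation act_ s A := (factor_act T s A).
Hypothesis phi21 : forall s v, phi (act_ s (e ix2 ix1) v) = x s * phi v.
Hypothesis phi32 : forall s v, phi (act_ s (e ix3 ix2) v) = y s * phi v.
Hypothesis phi31 : forall s v, phi (act_ s (e ix3 ix1) v) = 0.
Context (X : 8.-tuple (sl3 K)) (X_orthonormal : orthonormal_basis X).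

Lemma casimirE (r s : 'I_n) (v : T) : casimir X r s v =
  \sum_(p <- dual_terms K) p.1 *: act_ r p.2.1 (act_ s p.2.2 v).
Proof.
have K3 : (3%:R : K) != 0 by rewrite pnatr_eq0.
apply: (casimir_bilinear K3 X_orthonormal (b := fun A B => act_ r A (act_ s B v))).
- by move=> c A A' B; rewrite factor_act_linear.
- by move=> c A B B'; rewrite factor_act_linear linearP.
Qed.

Ltac abstract_phi := repeat match goal with |- context [phi ?t] => move: (phi t) => ? end.

(** As s and r differ, the lowering factor of each root term can be moved to the left, where phi
    evaluates it; the e_13 terms vanish because phi annihilates e_31. *)
Lemma phi_casimir (s r : 'I_n) (v : T) : s != r -> phi (casimir X s r v) =
  x r * phi (act_ s (e ix1 ix2) v) + x s * phi (act_ r (e ix1 ix2) v)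
  + y r * phi (act_ s (e ix2 ix3) v) + y s * phi (act_ r (e ix2 ix3) v)
  + (2%:R / 3%:R * phi (act_ s (h1 K) (act_ r (h1 K) v))
     + 3%:R^-1 * phi (act_ s (h1 K) (act_ r (h2 K) v))
     + 3%:R^-1 * phi (act_ s (h2 K) (act_ r (h1 K) v))
     + 2%:R / 3%:R * phi (act_ s (h2 K) (act_ r (h2 K) v))).
Proof.
move=> sr; rewrite casimirE !big_cons big_nil /= !linearD !linearZ /= linear0.
rewrite (factor_actC (e ix1 ix2) _ _ sr) (factor_actC (e ix1 ix3) _ _ sr).
rewrite (factor_actC (e ix2 ix3) _ _ sr) !phi21 !phi32 !phi31 /GRing.scale /=.
by abstract_phi; ring.
Qed.

Section Swap.
Context (A : sl3 K) (a : 'I_n -> K).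
Hypothesis phiA : forall s v, phi (act_ s A v) = a s * phi v.

Lemma phi_swap B s k (v : T) : phi (act_ s B (act_ k A v)) =
  a k * phi (act_ s B v) + (s == k)%:R * phi (act_ k (sl3_bracket B A) v).
Proof.
have [<-|sk] := eqVneq s k; last by rewrite factor_actC // phiA mul0r addr0.
by rewrite factor_act_bracket linearB /= phiA mul1r addrCA subrr addr0.
Qed.

Lemma phi_swap_eigen B c s k (v : T) : sl3_bracket B A = c *: A ->
  phi (act_ s B (act_ k A v)) = a k * phi (act_ s B v) + (s == k)%:R * (c * (a k * phi v)).
Proof. by move=> BA; rewrite phi_swap BA factor_actZ linearZ /= phiA. Qed.

Lemma phi_swap2 B b C c s r k (v : T) : s != r ->
  sl3_bracket B A = b *: A -> sl3_bracket C A = c *: A ->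
  phi (act_ s B (act_ r C (act_ k A v))) = a k * phi (act_ s B (act_ r C v))
  + (r == k)%:R * (c * (a k * phi (act_ s B v)))
  + (s == k)%:R * (b * (a k * phi (act_ r C v))).
Proof.
move=> sr BA CA; have [<-|rk] := eqVneq r k.
  rewrite (negPf sr) mul0r addr0 !(factor_actC B _ _ sr).
  by rewrite (phi_swap_eigen _ _ _ CA) eqxx mul1r.
by rewrite (factor_actC C _ _ rk) (phi_swap_eigen _ _ _ BA) mul0r addr0.
Qed.

(** The common computation for A = e_21, e_32, e_31: a commutator arises only when k is one of the
    two sites of the Casimir operator. *)
Lemma phi_casimir_swap (c1 c2 : K) (B12 B23 : sl3 K) (s r k : 'I_n) (v : T) : s != r ->
  sl3_bracket (e ix1 ix2) A = B12 -> sl3_bracket (e ix2 ix3) A = B23 ->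
  sl3_bracket (h1 K) A = c1 *: A -> sl3_bracket (h2 K) A = c2 *: A ->
  phi (casimir X s r (act_ k A v)) = a k * phi (casimir X s r v)
  + (s == k)%:R * (x r * phi (act_ k B12 v) + y r * phi (act_ k B23 v)
      + a k / 3%:R * ((2%:R * c1 + c2) * phi (act_ r (h1 K) v)
                      + (c1 + 2%:R * c2) * phi (act_ r (h2 K) v)))
  + (r == k)%:R * (x s * phi (act_ k B12 v) + y s * phi (act_ k B23 v)
      + a k / 3%:R * ((2%:R * c1 + c2) * phi (act_ s (h1 K) v)
                      + (c1 + 2%:R * c2) * phi (act_ s (h2 K) v))).
Proof.
move=> sr A12 A23 A1 A2; rewrite !phi_casimir //.
rewrite !(phi_swap (e ix1 ix2)) !(phi_swap (e ix2 ix3)) A12 A23.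
rewrite (phi_swap2 _ _ sr A1 A1) (phi_swap2 _ _ sr A1 A2).
rewrite (phi_swap2 _ _ sr A2 A1) (phi_swap2 _ _ sr A2 A2).
abstract_phi; by field.
Qed.
End Swap.

(** Here c1 = -2 and c2 = 1, so 2 c1 + c2 = -3 and c1 + 2 c2 = 0: the Cartan terms involve only h_1,
    and together with [e_12, e_21] = h_1 they form the antisymmetric expression. *)
Lemma phi_casimir_e21 (s r k : 'I_n) (v : T) : s != r ->
  phi (casimir X s r (act_ k (e ix2 ix1) v)) = x k * phi (casimir X s r v)
  + ((s == k)%:R - (r == k)%:R) * (x r * phi (act_ s (h1 K) v) - x s * phi (act_ r (h1 K) v)).
Proof.
move=> sr; rewrite (phi_casimir_swap phi21 _ _ sr (bracket_e12_e21 K) (bracket_e23_e21 K)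
  (bracket_h1_e21 K) (etrans (bracket_h2_e21 K) (esym (scale1r _)))).
rewrite factor_act0 linear0.
have [<-|sk] := eqVneq s k; [rewrite eq_sym (negPf sr)|have [<-|rk] := eqVneq r k];
  by rewrite /=; abstract_phi; field.
Qed.

Lemma phi_casimir_e32 (s r k : 'I_n) (v : T) : s != r ->
  phi (casimir X s r (act_ k (e ix3 ix2) v)) = y k * phi (casimir X s r v)
  + ((s == k)%:R - (r == k)%:R) * (y r * phi (act_ s (h2 K) v) - y s * phi (act_ r (h2 K) v)).
Proof.
move=> sr; rewrite (phi_casimir_swap phi32 _ _ sr (bracket_e12_e32 K) (bracket_e23_e32 K)
  (etrans (bracket_h1_e32 K) (esym (scale1r _))) (bracket_h2_e32 K)).
rewrite factor_act0 linear0.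
have [<-|sk] := eqVneq s k; [rewrite eq_sym (negPf sr)|have [<-|rk] := eqVneq r k];
  by rewrite /=; abstract_phi; field.
Qed.

Lemma phi_casimir_e31 (s r k : 'I_n) (v : T) : s != r ->
  phi (casimir X s r (act_ k (e ix3 ix1) v)) =
  ((s == k)%:R - (r == k)%:R) * (x s * y r - x r * y s) * phi v.
Proof.
(* Puts the vanishing on e_31 into the eigenvalue form required by [phi_casimir_swap], with
   eigenvalue 0. *)
have phi31' s' v' : phi (act_ s' (e ix3 ix1) v') = (fun=> 0) s' * phi v'.
  by rewrite phi31 mul0r.
move=> sr; rewrite (phi_casimir_swap phi31' _ _ sr (bracket_e12_e31 K) (bracket_e23_e31 K)
  (etrans (bracket_h1_e31 K) (esym (scaleN1r _)))
  (etrans (bracket_h2_e31 K) (esym (scaleN1r _)))).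
rewrite factor_actN linearN /= phi21 phi32.
have [<-|sk] := eqVneq s k; [rewrite eq_sym (negPf sr)|have [<-|rk] := eqVneq r k];
  by rewrite /=; abstract_phi; ring.
Qed.
End WhittakerGaudin.

Section PhiGaudin.
Context (K : numFieldType) (n : nat) (M : 'I_n -> sl3_module K).
Context (T : tensor_product M) (phi : {linear T -> K^o}).
Context (X : 8.-tuple (sl3 K)) (z : 'I_n -> K) (z_inj : injective z).

Lemma phi_current A u v :
  phi (current z A u v) = \sum_s (u - z s)^-1 * phi (factor_act T s A v).
Proof. by rewrite linear_sum; apply: eq_bigr => s _; rewrite linearZ. Qed.

Lemma phi_casimir_current A u v r s : phi (casimir X r s (current z A u v)) =
  \sum_k (u - z k)^-1 * phi (casimir X r s (factor_act T k A v)).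
Proof.
rewrite /casimir linear_sum.
under [RHS]eq_bigr do rewrite linear_sum mulr_sumr.
rewrite [RHS]exchange_big; apply: eq_bigr => i _.
rewrite [factor_act T s _ _]linear_sum [factor_act T r _ _]linear_sum linear_sum.
by apply: eq_bigr => k _; rewrite !linearZ.
Qed.

(** The vanishing of sum_s a_s / (u - z_s) removes the terms with phi(Casimir v). The difference
    1/(u - z_s) - 1/(u - z_r) left by the commutators cancels the denominator z_s - z_r of H_s. *)
Lemma phi_gaudin_current A (a : 'I_n -> K) (R : 'I_n -> 'I_n -> K) u v s :
  (forall s r k, s != r -> phi (casimir X s r (factor_act T k A v)) =
     a k * phi (casimir X s r v) + ((s == k)%:R - (r == k)%:R) * R s r) ->
  (forall s, R s s = 0) -> (forall s, u - z s != 0) ->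
  \sum_s a s / (u - z s) = 0 ->
  phi (gaudin X z s (current z A u v)) = (u - z s)^-1 * \sum_r R s r / (u - z r).
Proof.
move=> phiA R0 uz a0; rewrite /gaudin linear_sum mulr_sumr.
rewrite [RHS](bigD1 s) //= R0 mul0r mulr0 add0r; apply: eq_bigr => r rs.
rewrite linearZ /= phi_casimir_current.
transitivity ((z s - z r)^-1 * (\sum_k a k / (u - z k) * phi (casimir X s r v)
    + (\sum_k (s == k)%:R / (u - z k) - \sum_k (r == k)%:R / (u - z k)) * R s r)).
  congr (_ * _); rewrite -sumrB mulr_suml -big_split; apply: eq_bigr => k _ /=.
  by rewrite phiA 1?eq_sym //; ring.
have delta (q : 'I_n) : \sum_k (q == k)%:R / (u - z k) = (u - z q)^-1.
  rewrite (bigD1 q) //= eqxx mul1r big1 ?addr0 // => k kq.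
  by rewrite eq_sym (negPf kq) mul0r.
rewrite !delta -mulr_suml a0 mul0r add0r.
have zz : z s - z r != 0 by rewrite subr_eq0 (inj_eq z_inj) eq_sym.
by field; rewrite !uz zz.
Qed.
End PhiGaudin.

(** * The Bethe equations *)

Section PoleSums.
Context (K : fieldType) (n : nat) (z : 'I_n -> K).

Definition pole_sum (f : 'I_n -> K) (u : K) : K := \sum_s f s / (u - z s).

Lemma pole_sum_double f u v : u != v -> (forall s, u - z s != 0) -> (forall s, v - z s != 0) ->
  \sum_s (f s / (u - z s)) / (v - z s) = (pole_sum f v - pole_sum f u) / (u - v).
Proof.
move=> uv uz vz; rewrite /pole_sum -sumrB mulr_suml; apply: eq_bigr => s _.
have uv0 : u - v != 0 by rewrite subr_eq0.
by field; rewrite uz vz uv0.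
Qed.

(** [pole_sum_double] separates the double poles. The f-terms simplify because [pole_sum f t = 0],
    and the terms with [pole_sum g t] cancel against the last sum on the left. *)
Lemma bethe_sum (I J : finType) (P : pred I) (u : I -> K) (v : J -> K) (m f g : 'I_n -> K) t :
  pole_sum f t = 0 ->
  (forall i, P i -> u i != t) -> (forall j, v j != t) ->
  (forall s, t - z s != 0) -> (forall i s, u i - z s != 0) -> (forall j s, v j - z s != 0) ->
  (forall i, P i -> pole_sum f (u i) != 0) -> (forall j, pole_sum g (v j) != 0) ->
  \sum_s (m s - \sum_(i | P i) 2%:R * (f s / (u i - z s)) / pole_sum f (u i)
          + \sum_j g s / (v j - z s) / pole_sum g (v j)) / (t - z s)
  + \sum_j pole_sum g t / ((t - v j) * pole_sum g (v j))
  = \sum_s m s / (t - z s) - \sum_(i | P i) 2%:R / (t - u i) + \sum_j 1 / (t - v j).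
Proof.
move=> ft ut vt tz uz vz fu gv.
have -> : \sum_s (m s - \sum_(i | P i) 2%:R * (f s / (u i - z s)) / pole_sum f (u i)
          + \sum_j g s / (v j - z s) / pole_sum g (v j)) / (t - z s) =
    \sum_s m s / (t - z s)
    - \sum_(i | P i) 2%:R / pole_sum f (u i) * (\sum_s (f s / (u i - z s)) / (t - z s))
    + \sum_j (pole_sum g (v j))^-1 * (\sum_s (g s / (v j - z s)) / (t - z s)).
  under eq_bigr do rewrite mulrDl mulrBl !mulr_suml.
  rewrite big_split sumrB /=; congr (_ - _ + _).
    rewrite exchange_big; apply: eq_bigr => i _; rewrite mulr_sumr.
    by apply: eq_bigr => s _; ring.
  rewrite exchange_big; apply: eq_bigr => j _; rewrite mulr_sumr.
  by apply: eq_bigr => s _; ring.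
rewrite -addrA -big_split /=; congr (_ - _ + _); apply: eq_bigr => i.
  move=> Pi; rewrite pole_sum_double ?ut // ft sub0r.
  have ut0 : u i - t != 0 by rewrite subr_eq0 ut.
  have tu0 : t - u i != 0 by rewrite subr_eq0 eq_sym ut.
  by field; rewrite ut0 tu0 fu.
move=> _; rewrite pole_sum_double //.
have vt0 : v i - t != 0 by rewrite subr_eq0 vt.
have tv0 : t - v i != 0 by rewrite subr_eq0 eq_sym vt.
by field; rewrite vt0 tv0 gv.
Qed.

(** Since [pole_sum f t = 0], only the parts with the factor f s survive in the antisymmetric sums
    over r. The expression is then the left-hand side of [bethe_sum] times the nonzero factor - f s
    p / (t - z s). *)
Lemma bethe_sum0 (I J : finType) (P : pred I) (u : I -> K) (v : J -> K) (m b f g : 'I_n -> K) t s p :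
  pole_sum f t = 0 ->
  (forall i, P i -> u i != t) -> (forall j, v j != t) ->
  (forall s, t - z s != 0) -> (forall i s, u i - z s != 0) -> (forall j s, v j - z s != 0) ->
  (forall i, P i -> pole_sum f (u i) != 0) -> (forall j, pole_sum g (v j) != 0) ->
  f s != 0 -> p != 0 ->
  (forall r, b r = p * (m r - \sum_(i | P i) 2%:R * (f r / (u i - z r)) / pole_sum f (u i)
          + \sum_j g r / (v j - z r) / pole_sum g (v j))) ->
  (t - z s)^-1 * (\sum_r (f r * b s - f s * b r) / (t - z r))
  + \sum_j (t - v j)^-1 * ((t - z s)^-1 *
      \sum_r (f r * g s - f s * g r) * (p / pole_sum g (v j)) / (t - z r)) = 0 ->
  \sum_r m r / (t - z r) - \sum_(i | P i) 2%:R / (t - u i) + \sum_j 1 / (t - v j) = 0.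
Proof.
move=> ft ut vt tz uz vz fu gv fs p0 bE.
have cross (d e : 'I_n -> K) : \sum_r (f r * d s - f s * d r) * e s / (t - z r) =
    - f s * e s * pole_sum d t.
  rewrite (eq_bigr (fun r => d s * e s * (f r / (t - z r)) - f s * e s * (d r / (t - z r)))).
    by rewrite sumrB -!mulr_sumr -/(pole_sum f t) ft mulr0 sub0r -mulNr -mulNr.
  by move=> r _; ring.
have -> : \sum_r (f r * b s - f s * b r) / (t - z r) = - f s * pole_sum b t.
  transitivity (\sum_r (f r * b s - f s * b r) * 1 / (t - z r)).
    by apply: eq_bigr => r _; rewrite mulr1.
  by rewrite (cross b (fun=> 1)) mulr1.
rewrite -(bethe_sum m ft ut vt tz uz vz fu gv) => E.
set S := (X in X = 0); apply/eqP.
have : - (t - z s)^-1 * f s * p * S == 0.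
  rewrite -E; apply/eqP; rewrite /S mulrDr; congr (_ + _).
    rewrite /pole_sum [RHS]mulrA !mulr_sumr; apply: eq_bigr => r _.
    by rewrite bE; ring.
  rewrite mulr_sumr; apply: eq_bigr => j _.
  rewrite (cross g (fun=> p / pole_sum g (v j))) invfM; ring.
by rewrite !mulf_eq0 oppr_eq0 invr_eq0 (negPf (tz s)) (negPf fs) (negPf p0).
Qed.
End PoleSums.

Section BetheEquations.
Context (K : numFieldType) (n : nat) (z : 'I_n -> K) (z_inj : injective z).
Context (Lambda : 'I_n -> weight K) (M : forall j, verma_module (Lambda j)).
Context (T : tensor_product (fun j => M j)).
Context (X : 8.-tuple (sl3 K)) (X_orthonormal : orthonormal_basis X).
Context (l1 l2 : nat) (t1 : 'I_l1 -> K) (t2 : 'I_l2 -> K).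
Hypothesis t1_inj : injective t1.
Hypothesis t2_inj : injective t2.
Hypothesis t12 : forall i j, t1 i != t2 j.
Hypothesis zt1 : forall s i, z s != t1 i.
Hypothesis zt2 : forall s j, z s != t2 j.
Context (x y : 'I_n -> K) (phi : {linear T -> K^o}).
Notation e := (sl3_e K).
Notation act_ s A := (factor_act T s A).
Hypothesis phi_vac : phi (tensor T (fun j => verma_vec (M j))) = 1.
Hypothesis phi21 : forall s v, phi (act_ s (e ix2 ix1) v) = x s * phi v.
Hypothesis phi32 : forall s v, phi (act_ s (e ix3 ix2) v) = y s * phi v.
Hypothesis phi31 : forall s v, phi (act_ s (e ix3 ix1) v) = 0.
Notation Om := (Omega z t1 t2 T).
Notation F i := (pole_sum z x (t1 i)).
Notation G j := (pole_sum z y (t2 j)).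
Implicit Types (L : {set 'I_l1 + 'I_l2}).

Lemma phi_current_eigen A (a : 'I_n -> K) u v :
  (forall s v, phi (act_ s A v) = a s * phi v) ->
  phi (current z A u v) = pole_sum z a u * phi v.
Proof.
move=> phiA; rewrite phi_current mulr_suml; apply: eq_bigr => s _.
by rewrite phiA; ring.
Qed.

Lemma phi_current31 u v : phi (current z (e ix3 ix1) u v) = 0.
Proof. by rewrite phi_current big1 // => s _; rewrite phi31 mulr0. Qed.

Lemma phi_Om1 L i : inl i \in L -> phi (Om L) = F i * phi (Om (L :\ inl i)).
Proof.
move=> iL; rewrite (Omega_t1 z t1 t2 T iL) linearD /= (phi_current_eigen _ _ phi21).
rewrite [X in _ + X]linear_sum [X in _ + X]big1 ?addr0 // => j _.
by rewrite linearZ /= phi_current31 scaler0.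
Qed.

Lemma phi_Om2 L j : inr j \in L -> phi (Om L) = G j * phi (Om (L :\ inr j)).
Proof.
move=> jL; rewrite (Omega_t2 T _ zt1 zt2 jL) //.
rewrite linearD /= (phi_current_eigen _ _ phi32).
rewrite [X in _ + X]linear_sum [X in _ + X]big1 ?addr0 // => i _.
by rewrite linearZ /= phi_current31 scaler0.
Qed.

Lemma phi_Om0 : phi (Om set0) = 1.
Proof. by rewrite Omega0 phi_vac. Qed.

Lemma phi_Om_neq0 L : (forall i, inl i \in L -> F i != 0) ->
  (forall j, inr j \in L -> G j != 0) -> phi (Om L) != 0.
Proof.
have [m] := ubnP #|L|; elim: m L => // m IHm L Lm F0 G0.
have [->|[k kL]] := set_0Vmem L; first by rewrite phi_Om0 oner_neq0.
have Lkm : (#|L :\ k| < m)%N by move: Lm; rewrite (cardsD1 k) kL.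
have IH : phi (Om (L :\ k)) != 0.
  by apply: IHm => // [i|j]; rewrite inE => /andP[_]; [apply: F0|apply: G0].
case: k kL {Lkm} IH => [i|j] kL IH.
  by rewrite (phi_Om1 kL) mulf_neq0 // F0.
by rewrite (phi_Om2 kL) mulf_neq0 // G0.
Qed.

Lemma phi_act_current A B (a : 'I_n -> K) c u v s :
  (forall s v, phi (act_ s A v) = a s * phi v) -> sl3_bracket B A = c *: A ->
  phi (act_ s B (current z A u v)) =
  pole_sum z a u * phi (act_ s B v) + c * (a s / (u - z s)) * phi v.
Proof.
move=> phiA BA; rewrite /current !linear_sum /=.
transitivity (\sum_k (a k / (u - z k) * phi (act_ s B v)
    + (s == k)%:R * (c * (a k / (u - z k)) * phi v))).
  apply: eq_bigr => k _; rewrite !linearZ /= (phi_swap phiA) BA factor_actZ linearZ /= phiA.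
  by rewrite /GRing.scale /=; ring.
rewrite big_split /= -mulr_suml; congr (_ + _).
rewrite (bigD1 s) //= eqxx mul1r big1 ?addr0 // => k ks.
by rewrite eq_sym (negPf ks) mul0r.
Qed.

(** Induction on the size of L. Taking out t1_i multiplies phi by F i, and the commutator of h with
    the current adds - a1 x_s / (t1_i - z_s), which becomes a summand after division by F i; t2_j is
    similar. The E_31 terms stay in the kernel of phi, and the highest weight vectors give
    Lambda_s. *)
Lemma phi_cartan_Om (h : cartan K) a1 a2 a3 s L :
  sl3_bracket (vsval h) (e ix2 ix1) = - a1 *: e ix2 ix1 ->
  sl3_bracket (vsval h) (e ix3 ix2) = - a2 *: e ix3 ix2 ->
  sl3_bracket (vsval h) (e ix3 ix1) = a3 *: e ix3 ix1 ->
  (forall i, inl i \in L -> F i != 0) -> (forall j, inr j \in L -> G j != 0) ->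
  phi (act_ s (vsval h) (Om L)) = phi (Om L) * (Lambda s h
    - \sum_(i | inl i \in L) a1 * (x s / (t1 i - z s)) / F i
    - \sum_(j | inr j \in L) a2 * (y s / (t2 j - z s)) / G j).
Proof.
move=> h21 h32 h31.
have h31' u v : phi (act_ s (vsval h) (current z (e ix3 ix1) u v)) = 0.
  rewrite (@phi_act_current _ _ (fun=> 0) _ _ _ _ _ h31).
    by rewrite /pole_sum big1 ?mul0r ?mulr0 ?mul0r ?addr0 // => ? _; rewrite mul0r.
  by move=> *; rewrite phi31 mul0r.
have [m] := ubnP #|L|; elim: m L => // m IHm L Lm F0 G0.
have [->|[k kL]] := set_0Vmem L.
  rewrite Omega0 factor_act_cartan linearZ /= phi_vac mul1r.
  rewrite big1 => [|i]; last by rewrite inE.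
  rewrite big1 => [|i]; last by rewrite inE.
  by rewrite !subr0 /GRing.scale /= mulr1.
have Lkm : (#|L :\ k| < m)%N by move: Lm; rewrite (cardsD1 k) kL.
have F0' i : inl i \in L :\ k -> F i != 0 by rewrite inE => /andP[_]; apply: F0.
have G0' j : inr j \in L :\ k -> G j != 0 by rewrite inE => /andP[_]; apply: G0.
have {F0' G0' Lkm IHm}IH := IHm _ Lkm F0' G0'.
case: k kL IH => [i|j] kL IH.
  rewrite (phi_Om1 kL) (Omega_t1 z t1 t2 T kL) [act_ _ _ _]linearD linearD /=.
  rewrite (phi_act_current _ _ _ phi21 h21) IH.
  rewrite [X in _ + X = _](_ : _ = 0) ?addr0; last first.
    rewrite [act_ _ _ _]linear_sum [LHS]linear_sum big1 // => j _.
    by rewrite !linearZ /= h31' scaler0.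
  rewrite [in RHS](bigD1 i) //=.
  have -> : \sum_(i' | inl i' \in L :\ inl i) a1 * (x s / (t1 i' - z s)) / F i' =
      \sum_(i' | (inl i' \in L) && (i' != i)) a1 * (x s / (t1 i' - z s)) / F i'.
    by apply: eq_bigl => i'; rewrite !inE andbC.
  have -> : \sum_(j | inr j \in L :\ inl i) a2 * (y s / (t2 j - z s)) / G j =
      \sum_(j | inr j \in L) a2 * (y s / (t2 j - z s)) / G j.
    by apply: eq_bigl => j; rewrite !inE.
  have Fi := F0 i kL; have zi : t1 i - z s != 0 by rewrite subr_eq0 eq_sym.
  by field; rewrite Fi zi.
rewrite (phi_Om2 kL) (Omega_t2 T _ zt1 zt2 kL) // [act_ _ _ _]linearD linearD /=.
rewrite (phi_act_current _ _ _ phi32 h32) IH.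
rewrite [X in _ + X = _](_ : _ = 0) ?addr0; last first.
  rewrite [act_ _ _ _]linear_sum [LHS]linear_sum big1 // => i _.
  by rewrite !linearZ /= h31' scaler0.
rewrite [X in _ = _ * (_ - X)](bigD1 j) //=.
have -> : \sum_(j' | inr j' \in L :\ inr j) a2 * (y s / (t2 j' - z s)) / G j' =
    \sum_(j' | (inr j' \in L) && (j' != j)) a2 * (y s / (t2 j' - z s)) / G j'.
  by apply: eq_bigl => j'; rewrite !inE andbC.
have -> : \sum_(i | inl i \in L :\ inr j) a1 * (x s / (t1 i - z s)) / F i =
    \sum_(i | inl i \in L) a1 * (x s / (t1 i - z s)) / F i.
  by apply: eq_bigl => i; rewrite !inE.
have Gj := G0 j kL; have zj : t2 j - z s != 0 by rewrite subr_eq0 eq_sym.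
by field; rewrite Gj zj.
Qed.

Lemma gaudin_linear s : linear (gaudin X z s : T -> T).
Proof.
move=> c v w; rewrite /gaudin scaler_sumr -big_split; apply: eq_bigr => r _ /=.
rewrite scalerA mulrC -scalerA -scalerDr; congr (_ *: _).
rewrite /casimir scaler_sumr -big_split; apply: eq_bigr => k _ /=.
by rewrite !linearP.
Qed.
HB.instance Definition _ s := GRing.isLinear.Build K T T _ (gaudin X z s) (gaudin_linear s).

Lemma phi_gaudin_sum s (J : finType) (P : pred J) (c : J -> K) (v : J -> T) :
  phi (gaudin X z s (\sum_(j | P j) c j *: v j)) =
  \sum_(j | P j) c j * phi (gaudin X z s (v j)).
Proof.
have -> : gaudin X z s (\sum_(j | P j) c j *: v j) = \sum_(j | P j) c j *: gaudin X z s (v j).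
  by rewrite [LHS]linear_sum; apply: eq_bigr => j _; rewrite linearZ.
by rewrite linear_sum; apply: eq_bigr => j _; rewrite linearZ.
Qed.

Lemma phi_gaudin31 u v s : (forall s, u - z s != 0) ->
  phi (gaudin X z s (current z (e ix3 ix1) u v)) =
  (u - z s)^-1 * \sum_r (x s * y r - x r * y s) * phi v / (u - z r).
Proof.
move=> uz; rewrite (phi_gaudin_current z_inj (a := fun=> 0)
  (R := fun s r => (x s * y r - x r * y s) * phi v)) //.
- move=> r s' k rs; rewrite (phi_casimir_e31 phi21 phi32 phi31 X_orthonormal) //.
  by rewrite mul0r add0r mulrA.
- by move=> r; rewrite subrr mul0r.
- by rewrite big1 // => r _; rewrite mul0r.
Qed.

(** [bethe_sum0] is applied with f = x, g = y and p = phi(v1), where v1 is the weight function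
    without t1_i0. It is nonzero because no other F or G vanishes. *)
Lemma bethe_equation1 s (i0 : 'I_l1) :
  (exists mu, gaudin X z s (Om setT) = mu *: Om setT) ->
  F i0 = 0 -> (forall i, i != i0 -> F i != 0) -> (forall j, G j != 0) -> x s != 0 ->
  \sum_r Lambda r (ch1 K) / (t1 i0 - z r) - \sum_(i | i != i0) 2%:R / (t1 i0 - t1 i)
  + \sum_j 1 / (t1 i0 - t2 j) = 0.
Proof.
move=> [mu eigen] Fi0 F0 G0 xs.
have iL : inl i0 \in [set: 'I_l1 + 'I_l2] by rewrite inE.
have t1z i r : t1 i - z r != 0 by rewrite subr_eq0 eq_sym.
have t2z j r : t2 j - z r != 0 by rewrite subr_eq0 eq_sym.
set u := t1 i0; set v1 := Om ([set: _] :\ inl i0).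
have F0' i : inl i \in [set: 'I_l1 + 'I_l2] :\ inl i0 -> F i != 0.
  by rewrite !inE andbT => ii0; apply: F0; apply: contraNneq ii0 => ->.
have p0 : phi v1 != 0 by apply: phi_Om_neq0.
have b r : phi (act_ r (h1 K) v1) = phi v1 * (Lambda r (ch1 K)
    - \sum_(i | i != i0) 2%:R * (x r / (t1 i - z r)) / F i
    + \sum_j y r / (t2 j - z r) / G j).
  rewrite -vsval_ch1 (phi_cartan_Om (a1 := 2%:R) (a2 := -1) (a3 := -1)) ?vsval_ch1 //; last first.
  - by rewrite bracket_h1_e31 scaleN1r.
  - by rewrite bracket_h1_e32 opprK scale1r.
  - by rewrite bracket_h1_e21.
  congr (_ * (_ - _ + _)); first by apply: eq_bigl => i; rewrite !inE andbT.
  rewrite -sumrN; apply: eq_big => [j|j _]; first by rewrite !inE.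
  by rewrite !mulNr opprK mul1r.
apply: (bethe_sum0 (b := fun r => phi (act_ r (h1 K) v1)) Fi0 _ _ _ _ _ F0 G0 xs p0 b) => //.
- by move=> i ii0; rewrite (inj_eq t1_inj).
- by move=> j; rewrite eq_sym.
(* As F i0 = 0, phi annihilates Om, so the eigenvector relation becomes phi(H_s Om) = 0; expanding
   Om at t1_i0 gives the premise of [bethe_sum0]. *)
have := congr1 phi eigen.
rewrite linearZ /= (phi_Om1 iL) Fi0 mul0r scaler0 (Omega_t1 z t1 t2 T iL) -/v1 -/u => E.
rewrite -[RHS]E.
rewrite linearD linearD /=; congr (_ + _).
  rewrite (phi_gaudin_current z_inj (a := x) (R := fun s r =>
    x r * phi (act_ s (h1 K) v1) - x s * phi (act_ r (h1 K) v1))) //.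
  - by move=> r s' k rs; rewrite (phi_casimir_e21 phi21 phi32 phi31 X_orthonormal).
  - by move=> r; rewrite subrr.
  - by move=> r; rewrite /u.
rewrite [RHS]phi_gaudin_sum; apply: eq_big => [j|j _].
  by rewrite inE.
rewrite phi_gaudin31; last by move=> r; rewrite /u.
have -> : phi (Om ([set: _] :\ inl i0 :\ inr j)) = phi v1 / G j.
  have -> : phi v1 = G j * phi (Om ([set: _] :\ inl i0 :\ inr j)) by apply: phi_Om2; rewrite !inE.
  by rewrite mulrAC mulfV ?mul1r.
(* Both the coefficient 1/(t2_j - t1_i0) and the antisymmetric factor of [phi_gaudin31] have the
   sign opposite to that in [bethe_sum0], and the two signs cancel. *)
rewrite -[u - t2 j]opprB invrN /GRing.scale /= mulNr -mulrN -mulrN; congr (_ * (_ * _)).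
by rewrite -sumrN; apply: eq_bigr => r _; ring.
Qed.

Lemma bethe_equation2 s (j0 : 'I_l2) :
  (exists mu, gaudin X z s (Om setT) = mu *: Om setT) ->
  G j0 = 0 -> (forall j, j != j0 -> G j != 0) -> (forall i, F i != 0) -> y s != 0 ->
  \sum_r Lambda r (ch2 K) / (t2 j0 - z r) - \sum_(j | j != j0) 2%:R / (t2 j0 - t2 j)
  + \sum_i 1 / (t2 j0 - t1 i) = 0.
Proof.
move=> [mu eigen] Gj0 G0 F0 ys.
have jL : inr j0 \in [set: 'I_l1 + 'I_l2] by rewrite inE.
have t1z i r : t1 i - z r != 0 by rewrite subr_eq0 eq_sym.
have t2z j r : t2 j - z r != 0 by rewrite subr_eq0 eq_sym.
set u := t2 j0; set v1 := Om ([set: _] :\ inr j0).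
have G0' j : inr j \in [set: 'I_l1 + 'I_l2] :\ inr j0 -> G j != 0.
  by rewrite !inE andbT => jj0; apply: G0; apply: contraNneq jj0 => ->.
have p0 : phi v1 != 0 by apply: phi_Om_neq0.
have b r : phi (act_ r (h2 K) v1) = phi v1 * (Lambda r (ch2 K)
    - \sum_(j | j != j0) 2%:R * (y r / (t2 j - z r)) / G j
    + \sum_i x r / (t1 i - z r) / F i).
  rewrite -vsval_ch2 (phi_cartan_Om (a1 := -1) (a2 := 2%:R) (a3 := -1)) ?vsval_ch2 //; last first.
  - by rewrite bracket_h2_e31 scaleN1r.
  - by rewrite bracket_h2_e32.
  - by rewrite bracket_h2_e21 opprK scale1r.
  rewrite addrAC; congr (_ * (_ - _ + _)); first by apply: eq_bigl => j; rewrite !inE andbT.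
  rewrite -sumrN; apply: eq_big => [i|i _]; first by rewrite !inE.
  by rewrite !mulNr opprK mul1r.
apply: (bethe_sum0 (b := fun r => phi (act_ r (h2 K) v1)) Gj0 _ _ _ _ _ G0 F0 ys p0 b) => //.
- by move=> j jj0; rewrite (inj_eq t2_inj).
have := congr1 phi eigen.
rewrite linearZ /= (phi_Om2 jL) Gj0 mul0r scaler0 (Omega_t2 T _ zt1 zt2 jL) // -/v1 -/u => E.
rewrite -[RHS]E.
rewrite linearD linearD /=; congr (_ + _).
  rewrite (phi_gaudin_current z_inj (a := y) (R := fun s r =>
    y r * phi (act_ s (h2 K) v1) - y s * phi (act_ r (h2 K) v1))) //.
  - by move=> r s' k rs; rewrite (phi_casimir_e32 phi21 phi32 phi31 X_orthonormal).
  - by move=> r; rewrite subrr.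
  - by move=> r; rewrite /u.
rewrite [RHS]phi_gaudin_sum; apply: eq_big => [i|i _].
  by rewrite inE.
rewrite phi_gaudin31; last by move=> r; rewrite /u.
have -> : phi (Om ([set: _] :\ inl i :\ inr j0)) = phi v1 / F i.
  have -> : phi v1 = F i * phi (Om ([set: _] :\ inr j0 :\ inl i)) by apply: phi_Om1; rewrite !inE.
  by rewrite (setD1C _ (inr j0)) mulrAC mulfV ?mul1r.
congr (_ * (_ * _)).
by apply: eq_bigr => r _; ring.
Qed.
End BetheEquations.

(** * Choice of the Whittaker parameters and conclusion *)

Lemma pole_sum_two (K : fieldType) (n : nat) (z : 'I_n -> K) (a b : 'I_n) (c d : K) u :
  a != b ->
  pole_sum z (fun s => if s == a then c else if s == b then d else 0) u =
  c / (u - z a) + d / (u - z b).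
Proof.
move=> ab; rewrite /pole_sum (bigD1 a) //= (bigD1 b) 1?eq_sym //= big1 ?addr0 => [|s].
  by rewrite !eqxx eq_sym (negPf ab).
by move=> /andP[/negPf -> /negPf ->]; rewrite mul0r.
Qed.

(** Since alpha_1 takes the values 2 and -1 on h_1 and h_2, its coefficients in [riesz] are 1 and 0,
    that is, it is represented by h_1. *)
Lemma weight_form_alpha1 (K : numFieldType) (lam : weight K) :
  weight_form lam (alpha1 K) = lam (ch1 K).
Proof.
have K3 : (3%:R : K) != 0 by rewrite Num.Theory.pnatr_eq0.
rewrite /weight_form (riesz_form _ _ K3); congr (lam _).
rewrite /riesz /alpha1 !lfunE /= /root_fun vsval_ch1 vsval_ch2 !vsval_h !mxE /=.
have -> : (2 * (1 - 0 - (0 - 1)) + (0 - 0 - (1 - 0))) / 3%:R = 1 :> K by field.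
have -> : ((1 - 0 - (0 - 1)) + 2 * (0 - 0 - (1 - 0))) / 3%:R = 0 :> K by field.
by rewrite scale1r scale0r addr0.
Qed.

Lemma weight_form_alpha2 (K : numFieldType) (lam : weight K) :
  weight_form lam (alpha2 K) = lam (ch2 K).
Proof.
have K3 : (3%:R : K) != 0 by rewrite Num.Theory.pnatr_eq0.
rewrite /weight_form (riesz_form _ _ K3); congr (lam _).
rewrite /riesz /alpha2 !lfunE /= /root_fun vsval_ch1 vsval_ch2 !vsval_h !mxE /=.
have -> : (2 * (0 - 1 - (0 - 0)) + (1 - 0 - (0 - 1))) / 3%:R = 0 :> K by field.
have -> : ((0 - 1 - (0 - 0)) + 2 * (1 - 0 - (0 - 1))) / 3%:R = 1 :> K by field.
by rewrite scale1r scale0r add0r.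
Qed.

Lemma bethe_equations (K : numFieldType) (n : nat) (n_ge2 : (2 <= n)%N)
  (z : 'I_n -> K) (z_inj : injective z)
  (Lambda : 'I_n -> weight K) (M : forall s : 'I_n, verma_module (Lambda s))
  (T : tensor_product (fun s : 'I_n => M s))
  (X : 8.-tuple (sl3 K)) (X_orthonormal : orthonormal_basis X)
  (l1 l2 : nat) (t1 : 'I_l1 -> K) (t2 : 'I_l2 -> K)
  (t1_inj : injective t1) (t2_inj : injective t2)
  (t12 : forall i j, t1 i != t2 j)
  (zt1 : forall s i, z s != t1 i) (zt2 : forall s i, z s != t2 i)
  (eigen : forall s, exists mu,
     gaudin X z s (weight_function z t1 t2 T) = mu *: weight_function z t1 t2 T) :
  (forall i : 'I_l1,
     \sum_(s < n) Lambda s (ch1 K) / (t1 i - z s)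
     - \sum_(j < l1 | j != i) 2%:R / (t1 i - t1 j)
     + \sum_(j < l2) 1 / (t1 i - t2 j) = 0) /\
  (forall i : 'I_l2,
     \sum_(s < n) Lambda s (ch2 K) / (t2 i - z s)
     - \sum_(j < l2 | j != i) 2%:R / (t2 i - t2 j)
     + \sum_(j < l1) 1 / (t2 i - t1 j) = 0).
Proof.
pose a : 'I_n := Ordinal (ltnW n_ge2); pose b : 'I_n := Ordinal n_ge2.
have ab : a != b by [].
have zab : z a - z b != 0 by rewrite subr_eq0 (inj_eq z_inj).
rewrite weight_functionE in eigen.
(* pole_sum z (f t) u = (u - t) (z b - z a) / ((u - z a) (u - z b)) *)
pose f (t : K) s : K := if s == a then t - z a else if s == b then z b - t else 0.
(* The other parameter is supported at a alone: its pole sum is 1/(u - z a), which has no zeros. The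
   redundant second case matches the shape of [pole_sum_two]. *)
pose g s : K := if s == a then 1 else if s == b then 0 else 0.
have fa t : (forall s, z s != t) -> f t a != 0.
  by move=> zt; rewrite /f eqxx subr_eq0 eq_sym.
have ga : g a != 0 by rewrite /g eqxx oner_neq0.
have ft0 t : (forall s, z s != t) -> pole_sum z (f t) t = 0.
  move=> zt; rewrite pole_sum_two // -(opprB t) mulNr.
  by rewrite !divff ?subrr // subr_eq0 eq_sym.
have ft t u : (forall s, z s != t) -> (forall s, z s != u) -> u != t -> pole_sum z (f t) u != 0.
  move=> zt zu ut; rewrite pole_sum_two //.
  have ua : u - z a != 0 by rewrite subr_eq0 eq_sym.
  have ub : u - z b != 0 by rewrite subr_eq0 eq_sym.
  have -> : (t - z a) / (u - z a) + (z b - t) / (u - z b) =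
      (u - t) * (z b - z a) / ((u - z a) * (u - z b)) by field; rewrite ua ub.
  apply: mulf_neq0; last by rewrite invr_eq0 mulf_neq0.
  by rewrite mulf_neq0 ?subr_eq0 // (inj_eq z_inj).
have gt u : (forall s, z s != u) -> pole_sum z g u != 0.
  by move=> zu; rewrite pole_sum_two // mul0r addr0 mul1r invr_eq0 subr_eq0 eq_sym.
split=> i.
  have [phi [phi0 phi21 phi32 phi31]] := tensor_whittaker T (f (t1 i)) g.
  apply: (bethe_equation1 z_inj X_orthonormal t1_inj t12 zt1 zt2 phi0 phi21 phi32 phi31 (eigen a)) => //.
  - exact: ft0.
  - by move=> j ji; apply: ft; rewrite // (inj_eq t1_inj).
  - by move=> j; apply: gt.
  - exact: fa.
have [phi [phi0 phi21 phi32 phi31]] := tensor_whittaker T g (f (t2 i)).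
apply: (bethe_equation2 z_inj X_orthonormal t2_inj t12 zt1 zt2 phi0 phi21 phi32 phi31 (eigen a)) => //.
- exact: ft0.
- by move=> j ji; apply: ft; rewrite // (inj_eq t2_inj).
- by move=> j; apply: gt.
- exact: fa.
Qed.

Theorem theorem6p7p4
  (R : realType) (n : nat) (n_ge2 : (2 <= n)%N)
  (z : 'I_n -> R[i]) (z_inj : injective z)
  (Lambda : 'I_n -> weight R[i])
  (M : forall s : 'I_n, verma_module (Lambda s))
  (T : tensor_product (fun s : 'I_n => M s))
  (x : 8.-tuple (sl3 R[i])) (x_orthonormal : orthonormal_basis x)
  (l1 l2 : nat) (t1 : 'I_l1 -> R[i]) (t2 : 'I_l2 -> R[i])
  (t1_inj : injective t1) (t2_inj : injective t2)
  (t1_neq_t2 : forall i j, t1 i != t2 j)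
  (z_neq_t1 : forall s i, z s != t1 i)
  (z_neq_t2 : forall s i, z s != t2 i)
  (omega_eigen : forall i : 'I_n,
     eigenvector (gaudin x z i) (weight_function z t1 t2 T)) :
  (forall i : 'I_l1,
     \sum_(s < n) weight_form (Lambda s) (alpha1 _) / (t1 i - z s)
     - \sum_(j < l1 | j != i) 2%:R / (t1 i - t1 j)
     + \sum_(j < l2) 1 / (t1 i - t2 j) = 0) /\
  (forall i : 'I_l2,
     \sum_(s < n) weight_form (Lambda s) (alpha2 _) / (t2 i - z s)
     - \sum_(j < l2 | j != i) 2%:R / (t2 i - t2 j)
     + \sum_(j < l1) 1 / (t2 i - t1 j) = 0).
Proof.
have [eq1 eq2] := bethe_equations n_ge2 z_inj x_orthonormal t1_inj t2_inj
  t1_neq_t2 z_neq_t1 z_neq_t2 (fun s => (omega_eigen s).2).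
split=> i; [rewrite -[RHS](eq1 i)|rewrite -[RHS](eq2 i)]; congr (_ - _ + _);
  by apply: eq_bigr => s _; rewrite (weight_form_alpha1, weight_form_alpha2).
Qed.
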